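(* Let $n\wedge p\wedge q\to\infty$. Suppose that there are constants $a,b,a',b'$ not depending on $p,q$ with $0<a\le\inf_i \mathrm{var}(x_i)\le\sup_iE(x_i^2)\le b<\infty$ and $0<a'\le\inf_j \mathrm{var}(y_j)\le\sup_jE(y_j^2)\le b'<\infty$. (i) When $k(x,y)=l(x,y)=|x-y|^2$, $$dCov_n^2(\mathbf X,\mathbf Y)=\frac14\frac{\sqrt{pq}}{\tau}\,uCov_n^2(\mathbf X,\mathbf Y)+\mathcal R_n',$$ $$\tau\times hCov_n^2(\mathbf X,\mathbf Y)=\frac{\sqrt{pq}}{4\gamma_{\mathbf X}\gamma_{\mathbf Y}}f^{(1)}\!\left(\frac{\tau_X}{\gamma_{\mathbf X}}\right)g^{(1)}\!\left(\frac{\tau_Y}{\gamma_{\mathbf Y}}\right)uCov_n^2(\mathbf X,\mathbf Y)+\mathcal R_n'',$$ where $\mathcal R_n',\mathcal R_n''$ are the remainder terms (defined by these identities). Write $E[L_X(X,X')^2]=\alpha_p^2$, $E[L_Y(Y,Y')^2]=\beta_q^2$, $E[L_X(X,X')^4]=\gamma_p^2$, $E[L_Y(Y,Y')^4]=\lambda_q^2$ (with $\alpha_p,\beta_q,\gamma_p,\lambda_q\ge0$; $\gamma_p$ is unrelated to $\gamma_{\mathbf X},\gamma_{\mathbf Y}$). If in addition, as $n\wedge p\wedge q\to\infty$, $n\alpha_p=o(1)$, $n\beta_q=o(1)$, $\tau_X^2(\alpha_p\gamma_p+\gamma_p^2)=o(1)$, $\tau_Y^2(\beta_q\lambda_q+\lambda_q^2)=o(1)$,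 $\tau(\alpha_p\lambda_q+\gamma_p\beta_q+\gamma_p\lambda_q)=o(1)$, then $$uCov_n^2(\mathbf X,\mathbf Y)=O_p(\tau\alpha_p\beta_q),$$ $$\mathcal R_n'=O_p(\tau\alpha_p\lambda_q+\tau\gamma_p\beta_q+\tau\gamma_p\lambda_q)=o_p(1),\qquad \mathcal R_n''=O_p(\tau\alpha_p\lambda_q+\tau\gamma_p\beta_q+\tau\gamma_p\lambda_q)=o_p(1).$$ (ii) When $k(x,y)=l(x,y)=|x-y|$, $$mdCov_n^2(\mathbf X,\mathbf Y)=\sqrt{pq}\,\sqrt{\binom n2}\;uCov_n^2(\mathbf X,\mathbf Y).$$
   Context: Setting. For each $p,q$, $(X,Y)$ is a pair of random vectors $X=(x_1,\dots,x_p)^T\in\mathbb R^p$, $Y=(y_1,\dots,y_q)^T\in\mathbb R^q$ (whose law may depend on $p,q$). $(X_1,Y_1),\dots,(X_n,Y_n)$ are i.i.d. copies of $(X,Y)$, with $X_s=(x_{s1},\dots,x_{sp})^T$, $Y_s=(y_{s1},\dots,y_{sq})^T$; $\mathbf X=(X_1,\dots,X_n)^T$, $\mathbf Y=(Y_1,\dots,Y_n)^T$; $\mathcal X_i=(x_{1i},\dots,x_{ni})^T$, $\mathcal Y_j=(y_{1j},\dots,y_{nj})^T$. $|\cdot|$ is the Euclidean norm; $(X',Y')$ is an independent copy of $(X,Y)$. $\mathcal U$-centering. For an $n\times n$ matrix $\mathbf A=(a_{st})$ with zero diagonal, $\widetilde{\mathbf A}=(\tilde a_{st})$ has $\tilde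 a_{ss}=0$ and, for $s\neq t$, $\tilde a_{st}=a_{st}-\frac1{n-2}\sum_{v}a_{sv}-\frac1{n-2}\sum_{u}a_{ut}+\frac1{(n-1)(n-2)}\sum_{u,v}a_{uv}$; $(\widetilde{\mathbf A}\cdot\widetilde{\mathbf B})=\frac1{n(n-3)}\sum_{s\ne t}\tilde a_{st}\tilde b_{st}$. Statistics (all matrices below have zero diagonal; entries are given for $s\ne t$). - $dCov_n^2(\mathbf X,\mathbf Y)=(\widetilde{\mathbf A}\cdot\widetilde{\mathbf B})$, $a_{st}=|X_s-X_t|$, $b_{st}=|Y_s-Y_t|$. - $hCov_n^2(\mathbf X,\mathbf Y)=(\widetilde{\mathbf R}\cdot\widetilde{\mathbf H})$, $r_{st}=f(|X_s-X_t|/\gamma_{\mathbf X})$, $h_{st}=g(|Y_s-Y_t|/\gamma_{\mathbf Y})$, $\gamma_{\mathbf X}=\mathrm{median}\{|X_s-X_t|:s\ne t\}$, $\gamma_{\mathbf Y}=\mathrm{median}\{|Y_s-Y_t|:s\ne t\}$; each of $f,g$ is either $a\mapsto e^{-a^2/2}$ (Gaussian kernel) or $a\mapsto e^{-a}$ (Laplacian kernel), with derivatives $f^{(1)},g^{(1)}$. - $mdCov_n^2(\mathbf X,\mathbf Y)=\sqrt{\binom n2}\sum_{i=1}^p\sum_{j=1}^qdCov_n^2(\mathcal X_i,\mathcal Y_j)$, where $dCov_n^2(\mathcal X_i,\mathcal Y_j)=(\widetilde{\mathbf A}(i)\cdot\widetilde{\mathbf B}(j))$, $a_{st}(i)=|x_{si}-x_{ti}|$,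 $b_{st}(j)=|y_{sj}-y_{tj}|$. - $uCov_n^2(\mathbf X,\mathbf Y)=\frac1{\sqrt{pq}}\sum_{i=1}^p\sum_{j=1}^q(\widetilde{\mathbf K}(i)\cdot\widetilde{\mathbf L}(j))$, where $\mathbf K(i)=(k_{st}(i))$, $\mathbf L(j)=(l_{st}(j))$, $k_{st}(i)=k(x_{si},x_{ti})-E[k(x_{si},x_{ti})|x_{si}]-E[k(x_{si},x_{ti})|x_{ti}]+E[k(x_{si},x_{ti})]$, $l_{st}(j)=l(y_{sj},y_{tj})-E[l(y_{sj},y_{tj})|y_{sj}]-E[l(y_{sj},y_{tj})|y_{tj}]+E[l(y_{sj},y_{tj})]$ for bivariate kernels $k,l$. Notation: $\tau_X^2=E|X-X'|^2$, $\tau_Y^2=E|Y-Y'|^2$, $\tau=\tau_X\tau_Y$; $L_X(X,X')=\frac{|X-X'|^2-\tau_X^2}{\tau_X^2}$, $L_Y(Y,Y')=\frac{|Y-Y'|^2-\tau_Y^2}{\tau_Y^2}$. *)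

(* Defs.v *)
(* R^p is represented by p.-tuple R with its product sigma-algebra. *)
From HB Require Import structures.
From mathcomp Require Export all_boot all_order all_algebra.
From mathcomp Require Export all_classical all_reals all_analysis.
Set Implicit Arguments.
Unset Strict Implicit.
Unset Printing Implicit Defensive.
Export Order.TTheory GRing.Theory Num.Theory.
Export numFieldNormedType.Exports.
Local Open Scope classical_set_scope.
Local Open Scope ring_scope.

Definition edist (R : realType) (p : nat) (x y : p.-tuple R) : R :=
  Num.sqrt (\sum_(i < p) (tnth x i - tnth y i) ^+ 2).

Definition offdiag_mx (R : realType) (n : nat) (F : 'I_n -> 'I_n -> R) : 'M[R]_n :=
  \matrix_(s, t) (if s == t then 0 else F s t).

(* The denominators are computed in R: no truncated subtraction for n <= 3. *)
Definition Ucenter (R : realType) (n : nat) (A : 'M[R]_n) : 'M[R]_n :=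
  offdiag_mx (fun s t => A s t
    - (n%:R - 2)^-1 * \sum_v A s v
    - (n%:R - 2)^-1 * \sum_u A u t
    + ((n%:R - 1) * (n%:R - 2))^-1 * \sum_u \sum_v A u v).

Definition Udot (R : realType) (n : nat) (A B : 'M[R]_n) : R :=
  (n%:R * (n%:R - 3))^-1 *
  \sum_s \sum_(t | s != t) Ucenter A s t * Ucenter B s t.

(* Mean of the two middle order statistics (they coincide for odd size). *)
Definition median (R : realType) (s : seq R) : R :=
  let r := sort <=%R s in (r`_((size s).-1./2) + r`_((size s)./2)) / 2.

(* The family {|X_s - X_t| : s != t} is taken with multiplicities. *)
Definition median_dist (R : realType) (n p : nat) (x : 'I_n -> p.-tuple R) : R :=
  median [seq edist (x st.1) (x st.2)
         | st <- enum [pred st : 'I_n * 'I_n | st.1 != st.2]].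

Definition gaussian_kernel (R : realType) (a : R) : R := expR (- (a ^+ 2 / 2)).

Definition laplacian_kernel (R : realType) (a : R) : R := expR (- a).

Definition sq_kernel (R : realType) (x y : R) : R := `|x - y| ^+ 2.

Definition abs_kernel (R : realType) (x y : R) : R := `|x - y|.

Definition dCov2 (R : realType) (n p q : nat)
    (x : 'I_n -> p.-tuple R) (y : 'I_n -> q.-tuple R) : R :=
  Udot (offdiag_mx (fun s t => edist (x s) (x t)))
       (offdiag_mx (fun s t => edist (y s) (y t))).

Definition hCov2 (R : realType) (f g : R -> R) (n p q : nat)
    (x : 'I_n -> p.-tuple R) (y : 'I_n -> q.-tuple R) : R :=
  Udot (offdiag_mx (fun s t => f (edist (x s) (x t) / median_dist x)))
       (offdiag_mx (fun s t => g (edist (y s) (y t) / median_dist y))).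

Definition mdCov2 (R : realType) (n p q : nat)
    (x : 'I_n -> p.-tuple R) (y : 'I_n -> q.-tuple R) : R :=
  Num.sqrt ('C(n, 2))%:R *
  \sum_(i < p) \sum_(j < q)
    Udot (offdiag_mx (fun s t => `|tnth (x s) i - tnth (x t) i|))
         (offdiag_mx (fun s t => `|tnth (y s) j - tnth (y t) j|)).

Definition is_cond_exp (R : realType) (d dE : measure_display)
    (T : measurableType d) (E : measurableType dE) (P : probability T R)
    (Z : T -> R) (W : T -> E) (C : T -> R) : Prop :=
  [/\ measurable_fun [set: g_sigma_algebra_preimageType W] C,
      P.-integrable [set: T] (EFin \o C) &
      forall A : set T, g_sigma_algebra_preimage W A ->
        (\int[P]_(w in A) (C w)%:E = \int[P]_(w in A) (Z w)%:E)%E].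

(* A chosen version of E[Z | W]; 0 when there is none (Z not integrable).
   It is determined only up to a P-null set. *)
Definition cond_exp (R : realType) (d dE : measure_display)
    (T : measurableType d) (E : measurableType dE) (P : probability T R)
    (Z : T -> R) (W : T -> E) : T -> R :=
  xget (fun=> 0) [set C | is_cond_exp P Z W C].

Definition dcentered (R : realType) (d : measure_display) (T : measurableType d)
    (P : probability T R) (k : R -> R -> R) (U V : T -> R) (w : T) : R :=
  let Z := fun w => k (U w) (V w) in
  Z w - cond_exp P Z U w - cond_exp P Z V w + fine 'E_P[Z]%E.

Definition uCov2 (R : realType) (d : measure_display) (T : measurableType d)
    (P : probability T R) (k l : R -> R -> R) (n p q : nat)
    (X : 'I_n -> T -> p.-tuple R) (Y : 'I_n -> T -> q.-tuple R) (w : T) : R :=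
  (Num.sqrt (p%:R * q%:R))^-1 *
  \sum_(i < p) \sum_(j < q)
    Udot (offdiag_mx (fun s t =>
           dcentered P k (fun w => tnth (X s w) i) (fun w => tnth (X t w) i) w))
         (offdiag_mx (fun s t =>
           dcentered P l (fun w => tnth (Y s w) j) (fun w => tnth (Y t w) j) w)).

Definition same_law (R : realType) (d d' dE : measure_display)
    (T : measurableType d) (T' : measurableType d') (E : measurableType dE)
    (P : probability T R) (P' : probability T' R)
    (Z : T -> E) (Z' : T' -> E) : Prop :=
  forall A : set E, measurable A -> P (Z @^-1` A) = P' (Z' @^-1` A).

Definition mutually_independent (R : realType) (d dE : measure_display)
    (T : measurableType d) (E : measurableType dE) (P : probability T R)
    (I : finType) (Z : I -> T -> E) : Prop :=
  forall (J : {set I}) (A : I -> set E), (forall i, measurable (A i)) ->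
    P (\bigcap_(i in [set i | i \in J]) (Z i @^-1` A i)) =
    (\prod_(i in J) P (Z i @^-1` A i))%E.

Definition independent_copy (R : realType) (d dE : measure_display)
    (T : measurableType d) (E : measurableType dE) (P : probability T R)
    (Z Z' : T -> E) : Prop :=
  same_law P P Z' Z /\
  forall A B : set E, measurable A -> measurable B ->
    P (Z @^-1` A `&` Z' @^-1` B) = (P (Z @^-1` A) * P (Z' @^-1` B))%E.

Definition iid_copies (R : realType) (d d' dE : measure_display)
    (T : measurableType d) (T' : measurableType d') (E : measurableType dE)
    (P : probability T R) (P' : probability T' R)
    (I : finType) (Z : T -> E) (Zs : I -> T' -> E) : Prop :=
  mutually_independent P' Zs /\ forall i, same_law P' P (Zs i) Z.

(* tau: the root of E|U - U'|^2 (which is finite under second moments). *)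
Definition rms_dist (R : realType) (d : measure_display) (T : measurableType d)
    (P : probability T R) (p : nat) (U U' : T -> p.-tuple R) : R :=
  Num.sqrt (fine 'E_P[fun w => (edist (U w) (U' w) ^+ 2)%R]%E).

Definition rel_dev (R : realType) (d : measure_display) (T : measurableType d)
    (P : probability T R) (p : nat) (U U' : T -> p.-tuple R) (w : T) : R :=
  (edist (U w) (U' w) ^+ 2 - rms_dist P U U' ^+ 2) / rms_dist P U U' ^+ 2.

(* Z_k = O_p(r_k), each Z_k living on its own probability space. *)
Definition is_bigO_p (R : realType) (d : nat -> measure_display)
    (T : forall k, measurableType (d k)) (P : forall k, probability (T k) R)
    (Z : forall k, T k -> R) (r : nat -> R) : Prop :=
  forall e : R, 0 < e -> exists M : R, \forall k \near \oo,
    (P k [set w | (M * r k < `|Z k w|)%R] <= e%:E)%E.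

Definition is_littleo_p1 (R : realType) (d : nat -> measure_display)
    (T : forall k, measurableType (d k)) (P : forall k, probability (T k) R)
    (Z : forall k, T k -> R) : Prop :=
  forall e : R, 0 < e ->
    (fun k => P k [set w | (e < `|Z k w|)%R]) @ \oo --> (0 : \bar R)%E.

(* Main.v *)
(* Write |X_s - X_t|^2 = tau_X^2 (1 + L_st). U-centering annihilates matrices of
   the form h_s + h_t off the diagonal. So in uCov with the squared kernel the
   conditional centering can be dropped, and summing over the coordinates gives
   uCov = tau^2 / sqrt (pq) * (L~_X . L~_Y). Expanding sqrt (1 + L), or
   f (rho sqrt (1 + L)) with rho = tau_X / gamma_X, to first order in L gives the
   same leading term for dCov and hCov, with remainder matrices of entries
   O(L^2). U-centering is bounded in Frobenius norm, so Cauchy-Schwarz bounds all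
   these inner products by the sums of L_st^2 and L_st^4, which Markov's
   inequality controls by n^2 alpha^2, ..., n^2 lambda^2. Since n alpha -> 0, the
   bound on the sum of L_st^2 also makes all the L_st uniformly small, which keeps
   the random bandwidths gamma_X, gamma_Y comparable to tau_X, tau_Y. *)
From HB Require Import structures.
Require Import Defs.
From mathcomp Require Import measurable_realfun ring lra.
Set Implicit Arguments.
Unset Strict Implicit.
Unset Printing Implicit Defensive.
Local Open Scope classical_set_scope.
Local Open Scope ring_scope.

(** * U-centering *)

(** The argument is pathwise off an exceptional event. For each K, the four sums of L^2 and L^4
    exceed K^2 times the bounds on their means with total probability at most 4 / K^2. Elsewhere
    every estimate is a deterministic inequality whose constants do not depend on n, p, q, so the
    random bandwidths can be handled as fixed numbers. Each bound is a product of two Frobenius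
    norms, which turns K into K^2.

    The lower variance bounds give tau_X, tau_Y > 0, so that L_st is a genuine relative deviation.
    The upper moment bounds give tau <= C sqrt (pq), which reduces the factor tau^2 / sqrt (pq) of
    uCov to the order of tau.

    Two obstacles remain: conditional expectations are chosen versions, and the sample lives on
    another probability space than (X, Y), (X', Y'). Both are met by one fact, that the law of a
    pair is determined by its values on rectangles. The statistics, medians included, are shown to
    be measurable because events are compared by monotonicity of P. *)

Lemma sum_cauchy_schwarz (R : realType) (I : finType) (a b : I -> R) :
  (\sum_i a i * b i) ^+ 2 <= (\sum_i a i ^+ 2) * (\sum_i b i ^+ 2).
Proof.
(* Lagrange's identity. *)
have E : \sum_i \sum_j (a i * b j - a j * b i) ^+ 2 =
    2 * ((\sum_i a i ^+ 2) * (\sum_i b i ^+ 2)) - 2 * (\sum_i a i * b i) ^+ 2.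
  pose c i j := a i ^+ 2 * b j ^+ 2; pose e i j := (a i * b i) * (a j * b j).
  rewrite expr2 2!mulr_suml.
  have -> : \sum_i a i ^+ 2 * (\sum_j b j ^+ 2) = \sum_i \sum_j c i j.
    by apply: eq_bigr => i _; rewrite mulr_sumr.
  have -> : \sum_i a i * b i * (\sum_j a j * b j) = \sum_i \sum_j e i j.
    by apply: eq_bigr => i _; rewrite mulr_sumr.
  transitivity (\sum_i \sum_j c i j + \sum_i \sum_j c j i
      - 2 * \sum_i \sum_j e i j).
    rewrite mulr_sumr -sumrN -!big_split /=; apply: eq_bigr => i _.
    rewrite mulr_sumr -sumrN -!big_split /=.
    by apply: eq_bigr => j _; rewrite /c /e; ring.
  by rewrite [X in _ + X - _]exchange_big /=; ring.
suff : 0 <= \sum_i \sum_j (a i * b j - a j * b i) ^+ 2 by rewrite E; lra.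
by apply: sumr_ge0 => i _; apply: sumr_ge0 => j _; exact: sqr_ge0.
Qed.

Lemma sqr_sum_le (R : realType) (n : nat) (a : 'I_n -> R) :
  (\sum_i a i) ^+ 2 <= n%:R * \sum_i a i ^+ 2.
Proof.
have := sum_cauchy_schwarz (fun=> 1) a.
rewrite (eq_bigr a) => [|i _]; last by rewrite mul1r.
rewrite [X in _ <= X * _ -> _](eq_bigr (fun=> 1)) => [|i _]; last by rewrite expr1n.
by rewrite sumr_const card_ord.
Qed.

Definition frob (R : realType) (n : nat) (A : 'M[R]_n) : R :=
  \sum_s \sum_t A s t ^+ 2.

Lemma frob_ge0 (R : realType) (n : nat) (A : 'M[R]_n) : 0 <= frob A.
Proof. by apply: sumr_ge0 => s _; apply: sumr_ge0 => t _; exact: sqr_ge0. Qed.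

Lemma sum_mulmx_entries_le (R : realType) (n : nat) (A B : 'M[R]_n) :
  (\sum_s \sum_t A s t * B s t) ^+ 2 <= frob A * frob B.
Proof.
rewrite /frob !pair_big /=.
exact: (sum_cauchy_schwarz (fun i : 'I_n * 'I_n => A i.1 i.2)
  (fun i : 'I_n * 'I_n => B i.1 i.2)).
Qed.

Lemma eq_offdiag_mx (R : realType) (n : nat) (F G : 'I_n -> 'I_n -> R) :
  (forall s t, s != t -> F s t = G s t) -> offdiag_mx F = offdiag_mx G.
Proof. by move=> FG; apply/matrixP => s t; rewrite !mxE; case: eqVneq => // /FG. Qed.

Lemma offdiag_mxD (R : realType) (n : nat) (F G : 'I_n -> 'I_n -> R) :
  offdiag_mx (fun s t => F s t + G s t) = offdiag_mx F + offdiag_mx G.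
Proof. by apply/matrixP => s t; rewrite !mxE; case: eqP; rewrite ?addr0. Qed.

Lemma offdiag_mxZ (R : realType) (n : nat) c (F : 'I_n -> 'I_n -> R) :
  offdiag_mx (fun s t => c * F s t) = c *: offdiag_mx F.
Proof. by apply/matrixP => s t; rewrite !mxE; case: eqP; rewrite ?mulr0. Qed.

Lemma UcenterD (R : realType) (n : nat) (A B : 'M[R]_n) :
  Ucenter (A + B) = Ucenter A + Ucenter B.
Proof.
rewrite /Ucenter -offdiag_mxD; congr offdiag_mx.
apply/funext => s; apply/funext => t; rewrite mxE.
have -> : \sum_v (A + B) s v = \sum_v A s v + \sum_v B s v.
  by rewrite -big_split; apply: eq_bigr => v _; rewrite mxE.
have -> : \sum_v (A + B) v t = \sum_v A v t + \sum_v B v t.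
  by rewrite -big_split; apply: eq_bigr => v _; rewrite mxE.
have -> : \sum_u \sum_v (A + B) u v = \sum_u \sum_v A u v + \sum_u \sum_v B u v.
  rewrite -big_split; apply: eq_bigr => u _.
  by rewrite -big_split; apply: eq_bigr => v _; rewrite mxE.
ring.
Qed.

Lemma UcenterZ (R : realType) (n : nat) c (A : 'M[R]_n) :
  Ucenter (c *: A) = c *: Ucenter A.
Proof.
rewrite /Ucenter -offdiag_mxZ; congr offdiag_mx.
apply/funext => s; apply/funext => t; rewrite mxE.
have -> : \sum_v (c *: A) s v = c * \sum_v A s v.
  by rewrite mulr_sumr; apply: eq_bigr => v _; rewrite mxE.
have -> : \sum_v (c *: A) v t = c * \sum_v A v t.
  by rewrite mulr_sumr; apply: eq_bigr => v _; rewrite mxE.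
have -> : \sum_u \sum_v (c *: A) u v = c * \sum_u \sum_v A u v.
  rewrite mulr_sumr; apply: eq_bigr => u _.
  by rewrite mulr_sumr; apply: eq_bigr => v _; rewrite mxE.
ring.
Qed.

Lemma eq_Udotl (R : realType) (n : nat) (A A' B : 'M[R]_n) :
  Ucenter A = Ucenter A' -> Udot A B = Udot A' B.
Proof. by rewrite /Udot => ->. Qed.

Lemma UdotC (R : realType) (n : nat) (A B : 'M[R]_n) : Udot A B = Udot B A.
Proof.
by congr *%R; apply: eq_bigr => s _; apply: eq_bigr => t _; rewrite mulrC.
Qed.

Lemma UdotDl (R : realType) (n : nat) (A B C : 'M[R]_n) :
  Udot (A + B) C = Udot A C + Udot B C.
Proof.
rewrite /Udot -mulrDr -big_split; congr *%R; apply: eq_bigr => s _.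
by rewrite -big_split; apply: eq_bigr => t _; rewrite UcenterD mxE mulrDl.
Qed.

Lemma UdotZl (R : realType) (n : nat) c (A B : 'M[R]_n) :
  Udot (c *: A) B = c * Udot A B.
Proof.
rewrite /Udot mulrCA; congr *%R; rewrite mulr_sumr; apply: eq_bigr => s _.
by rewrite mulr_sumr; apply: eq_bigr => t _; rewrite UcenterZ mxE mulrA.
Qed.

Lemma UdotDr (R : realType) (n : nat) (A B C : 'M[R]_n) :
  Udot C (A + B) = Udot C A + Udot C B.
Proof. by rewrite UdotC UdotDl !(UdotC C). Qed.

Lemma UdotZr (R : realType) (n : nat) c (A B : 'M[R]_n) :
  Udot B (c *: A) = c * Udot B A.
Proof. by rewrite UdotC UdotZl (UdotC B). Qed.

Lemma Udot_suml (R : realType) (n : nat) (I : finType) (A : I -> 'M[R]_n) B :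
  Udot (\sum_i A i) B = \sum_i Udot (A i) B.
Proof.
elim/big_ind2: _ => // [|x1 x2 y1 y2 <- <-]; last exact: UdotDl.
by rewrite -(scale0r 0) UdotZl mul0r.
Qed.

Lemma Udot_sumr (R : realType) (n : nat) (I : finType) (A : I -> 'M[R]_n) B :
  Udot B (\sum_i A i) = \sum_i Udot B (A i).
Proof. by rewrite UdotC Udot_suml; apply: eq_bigr => i _; rewrite UdotC. Qed.

Lemma sum_offdiag_row (R : realType) (n : nat) (F : 'I_n -> 'I_n -> R) s :
  \sum_v offdiag_mx F s v = \sum_v F s v - F s s.
Proof.
rewrite (bigD1 s) //= mxE eqxx add0r [in RHS](bigD1 s) //= addrC addrK.
by apply: eq_bigr => v; rewrite mxE eq_sym => /negPf->.
Qed.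

Lemma sum_offdiag_col (R : realType) (n : nat) (F : 'I_n -> 'I_n -> R) t :
  \sum_u offdiag_mx F u t = \sum_u F u t - F t t.
Proof.
rewrite (bigD1 t) //= mxE eqxx add0r [in RHS](bigD1 t) //= addrC addrK.
by apply: eq_bigr => v; rewrite mxE => /negPf->.
Qed.

(** With Sh the sum of [h], the row sums off the diagonal are (n - 2) h_s + Sh and the grand total
    is 2 (n - 1) Sh. The normalizations n - 2 and (n - 1)(n - 2), made for zero diagonals, are
    exactly those for which everything cancels. *)
Lemma Ucenter_additive (R : realType) (n : nat) (h : 'I_n -> R) : (2 < n)%N ->
  Ucenter (offdiag_mx (fun s t => h s + h t)) = 0.
Proof.
move=> n2; apply/matrixP => s t; rewrite /Ucenter mxE [RHS]mxE.
case: eqP => // /eqP st; rewrite sum_offdiag_row sum_offdiag_col mxE (negPf st).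
pose Sh := \sum_v h v.
have E u : \sum_v (h u + h v) = n%:R * h u + Sh.
  by rewrite big_split /= sumr_const card_ord mulr_natl.
have -> : \sum_u (h u + h t) = n%:R * h t + Sh.
  by rewrite -E; apply: eq_bigr => i _; rewrite addrC.
rewrite E.
have -> : \sum_u \sum_v offdiag_mx (fun s t => h s + h t) u v =
    2 * (n%:R - 1) * Sh.
  transitivity (\sum_u ((n%:R - 2) * h u + Sh)).
    by apply: eq_bigr => u _; rewrite sum_offdiag_row E; ring.
  rewrite big_split /= -mulr_sumr sumr_const card_ord -/Sh -(mulr_natl Sh).
  ring.
have n2R : (n%:R - 2 : R) != 0.
  by rewrite subr_eq0 (eqr_nat R n 2) gtn_eqF.
have n1R : (n%:R - 1 : R) != 0.
  by rewrite subr_eq0 (eqr_nat R n 1) gtn_eqF // ltnW.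
by field; rewrite n2R n1R.
Qed.

(** Serves twice: with a constant [h] it discards the zeroth-order term of an expansion, and with
    conditional expectations as [h] it discards the double centering inside uCov. *)
Lemma Ucenter_add_additive (R : realType) (n : nat) (F G : 'I_n -> 'I_n -> R) h :
  (2 < n)%N -> (forall s t, s != t -> F s t = G s t + (h s + h t)) ->
  Ucenter (offdiag_mx F) = Ucenter (offdiag_mx G).
Proof.
move=> n2 /eq_offdiag_mx ->.
by rewrite offdiag_mxD UcenterD Ucenter_additive // addr0.
Qed.

Lemma frob_row_sums (R : realType) (n : nat) (A : 'M[R]_n) :
  \sum_s \sum_(t < n) (\sum_v A s v) ^+ 2 <= n%:R ^+ 2 * frob A.
Proof.
rewrite /frob mulr_sumr; apply: ler_sum => s _.
rewrite sumr_const card_ord -[X in X <= _]mulr_natl [n%:R ^+ 2]expr2 -mulrA ler_wpM2l ?ler0n //.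
exact: sqr_sum_le.
Qed.

Lemma frob_tr (R : realType) (n : nat) (A : 'M[R]_n) : frob A^T = frob A.
Proof.
rewrite /frob exchange_big.
by apply: eq_bigr => s _; apply: eq_bigr => t _; rewrite mxE.
Qed.

Lemma frob_col_sums (R : realType) (n : nat) (A : 'M[R]_n) :
  \sum_(s < n) \sum_t (\sum_u A u t) ^+ 2 <= n%:R ^+ 2 * frob A.
Proof.
rewrite exchange_big /= -frob_tr; apply: le_trans (frob_row_sums A^T).
apply: ler_sum => t _; apply: ler_sum => s _.
by under [X in _ <= X ^+ 2]eq_bigr do rewrite mxE.
Qed.

Lemma frob_total (R : realType) (n : nat) (A : 'M[R]_n) :
  (\sum_u \sum_v A u v) ^+ 2 <= n%:R ^+ 2 * frob A.
Proof.
apply: le_trans (sqr_sum_le _) _; rewrite [n%:R ^+ 2]expr2 -mulrA ler_wpM2l ?ler0n //.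
by rewrite mulr_sumr; apply: ler_sum => s _; exact: sqr_sum_le.
Qed.

(** The three ratios decrease in n, and at n = 4 they equal 2, 8/3 and 4. *)
Lemma natr_inv_bounds (R : realType) (n : nat) : (3 < n)%N ->
  [/\ n%:R * (n%:R - 2)^-1 <= 2 :> R,
      n%:R ^+ 2 * ((n%:R - 1) * (n%:R - 2))^-1 <= 3 :> R,
      n%:R ^+ 2 * (n%:R * (n%:R - 3))^-1 <= 4 :> R &
      4 <= n%:R :> R].
Proof.
move=> n3; have n4 : 4 <= n%:R :> R by rewrite (ler_nat R 4).
split=> //; rewrite ler_pdivrMr; try nra.
Qed.

Lemma sqr_four_le (R : realType) (x y z w : R) :
  (x - y - z + w) ^+ 2 <= 4 * (x ^+ 2 + y ^+ 2 + z ^+ 2 + w ^+ 2).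
Proof.
rewrite -subr_ge0.
have -> : 4 * (x ^+ 2 + y ^+ 2 + z ^+ 2 + w ^+ 2) - (x - y - z + w) ^+ 2 =
  (x + y) ^+ 2 + (x + z) ^+ 2 + (x - w) ^+ 2 + (y - z) ^+ 2 + (y + w) ^+ 2
  + (z + w) ^+ 2 by ring.
by rewrite !addr_ge0 // sqr_ge0.
Qed.

(** The constant is 72 = 4 (1 + 4 + 4 + 9): a factor 4 for the square of a sum of four terms, then 1
    for [A] itself and the squares of the bounds 2, 2, 3 of [natr_inv_bounds] for the row, column
    and total corrections. It is crude, but it does not depend on n. *)
Lemma frob_Ucenter (R : realType) (n : nat) (A : 'M[R]_n) : (3 < n)%N ->
  frob (Ucenter A) <= 72 * frob A.
Proof.
move=> n3; have [c1 c2 _ n4] := natr_inv_bounds R n3.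
set k1 := (n%:R - 2)^-1 in c1; set k2 := ((n%:R - 1) * (n%:R - 2))^-1 in c2.
have k10 : 0 <= k1 by rewrite invr_ge0; lra.
have k20 : 0 <= k2 by rewrite invr_ge0; nra.
pose r s := \sum_v A s v; pose c t := \sum_u A u t.
pose T := \sum_u \sum_v A u v.
apply: (@le_trans _ _ (\sum_s \sum_t 4 * (A s t ^+ 2 + k1 ^+ 2 * r s ^+ 2
    + k1 ^+ 2 * c t ^+ 2 + k2 ^+ 2 * T ^+ 2))).
  apply: ler_sum => s _; apply: ler_sum => t _.
  rewrite /Ucenter mxE -/k1 -/k2 -/(r s) -/(c t) -/T.
  case: eqP => _; last by rewrite -!exprMn; exact: sqr_four_le.
  by rewrite -!exprMn expr0n /= mulr_ge0 // !addr_ge0 // sqr_ge0.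
rewrite [X in X <= _](_ : _ = 4 * (frob A
    + k1 ^+ 2 * (\sum_s \sum_(t < n) r s ^+ 2)
    + k1 ^+ 2 * (\sum_(s < n) \sum_t c t ^+ 2)
    + k2 ^+ 2 * (n%:R ^+ 2 * T ^+ 2))); last first.
  have -> : n%:R ^+ 2 * T ^+ 2 = \sum_(s < n) \sum_(t < n) T ^+ 2.
    by rewrite !sumr_const !card_ord -mulrnA -[RHS]mulr_natl natrM expr2.
  rewrite /frob !mulr_sumr -!big_split /= mulr_sumr; apply: eq_bigr => s _.
  by rewrite !mulr_sumr -!big_split /= mulr_sumr.
have := frob_row_sums A; have := frob_col_sums A; have := frob_total A.
rewrite -/T -/r -/c.
set x := \sum_(s < n) \sum_t (\sum_u A u t) ^+ 2.
set y := \sum_s \sum_(t < n) (\sum_v A s v) ^+ 2; set f := frob A => H1 H2 H3.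
have f0 : 0 <= f by exact: frob_ge0.
have {}H2 : k1 ^+ 2 * x <= 4 * f.
  apply: le_trans (ler_wpM2l (sqr_ge0 _) H2) _.
  rewrite mulrA -exprMn ler_wpM2r // mulrC.
  have : 0 <= n%:R * k1 by rewrite mulr_ge0 ?ler0n.
  nra.
have {}H3 : k1 ^+ 2 * y <= 4 * f.
  apply: le_trans (ler_wpM2l (sqr_ge0 _) H3) _.
  rewrite mulrA -exprMn ler_wpM2r // mulrC.
  have : 0 <= n%:R * k1 by rewrite mulr_ge0 ?ler0n.
  nra.
have {}H1 : k2 ^+ 2 * (n%:R ^+ 2 * T ^+ 2) <= 9 * f.
  rewrite mulrA; apply: (@le_trans _ _ ((n%:R ^+ 2 * k2) ^+ 2 * f)).
    have -> : (n%:R ^+ 2 * k2) ^+ 2 * f = k2 ^+ 2 * n%:R ^+ 2 * (n%:R ^+ 2 * f) by ring.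
    by apply: ler_wpM2l => //; rewrite mulr_ge0 ?sqr_ge0.
  rewrite ler_wpM2r //.
  have : 0 <= n%:R ^+ 2 * k2 by rewrite mulr_ge0 ?sqr_ge0.
  nra.
lra.
Qed.

(** Cauchy-Schwarz with [frob_Ucenter] on both sides gives 72 n^2 x y, and the prefactor 1 / (n (n -
    3)) is at most 4 / n^2; hence 288 = 4 * 72. The radii are scaled by n because a matrix with
    entries of size x has Frobenius norm about n x. *)
Lemma Udot_le (R : realType) (n : nat) (A B : 'M[R]_n) (x y : R) : (3 < n)%N ->
  0 <= x -> 0 <= y -> frob A <= (n%:R * x) ^+ 2 -> frob B <= (n%:R * y) ^+ 2 ->
  `|Udot A B| <= 288 * (x * y).
Proof.
move=> n3 x0 y0 fA fB; have [_ _ c3 n4] := natr_inv_bounds R n3.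
set k := (n%:R * (n%:R - 3))^-1 in c3.
have k0 : 0 <= k by rewrite invr_ge0; nra.
rewrite /Udot -/k.
(* The diagonal can be added, since U-centered matrices vanish there. *)
have -> : \sum_s \sum_(t | s != t) Ucenter A s t * Ucenter B s t =
    \sum_s \sum_t Ucenter A s t * Ucenter B s t.
  apply: eq_bigr => s _; rewrite [RHS](bigD1 s) //= {2}/Ucenter mxE eqxx mul0r.
  by rewrite add0r; apply: eq_bigl => t; rewrite eq_sym.
set S := \sum_s _.
have HS : `|S| <= 72 * (n%:R ^+ 2 * (x * y)).
  rewrite -ler_sqr ?nnegrE ?mulr_ge0 ?sqr_ge0 // real_normK ?num_real //.
  apply: le_trans (sum_mulmx_entries_le _ _) _.
  have := frob_Ucenter A n3; have := frob_Ucenter B n3 => uB uA.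
  have -> : (72 * (n%:R ^+ 2 * (x * y))) ^+ 2 =
    (72 * (n%:R * x) ^+ 2) * (72 * (n%:R * y) ^+ 2) by ring.
  by apply: ler_pM; rewrite ?frob_ge0 //;
     [apply: le_trans uA _|apply: le_trans uB _]; rewrite ler_pM2l.
rewrite normrM ger0_norm //.
apply: le_trans (ler_wpM2l k0 HS) _.
have -> : k * (72 * (n%:R ^+ 2 * (x * y))) = (n%:R ^+ 2 * k) * (72 * (x * y)) by ring.
have -> : 288 * (x * y) = 4 * (72 * (x * y)) by ring.
by apply: ler_wpM2r => //; rewrite !mulr_ge0.
Qed.

(** * Perturbation of the U-centered inner product *)

Lemma ler_abs_sqr (R : realType) (x y : R) : (`|x| <= `|y|) = (x ^+ 2 <= y ^+ 2).
Proof.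
by rewrite -(real_normK (num_real x)) -(real_normK (num_real y)) ler_sqr ?nnegrE.
Qed.

Lemma frob_offdiag_le (R : realType) (n : nat) (F G : 'I_n -> 'I_n -> R) (c x : R) :
  0 <= c -> (forall s t, s != t -> `|F s t| <= c * `|G s t|) ->
  frob (offdiag_mx G) <= (n%:R * x) ^+ 2 ->
  frob (offdiag_mx F) <= (n%:R * (c * x)) ^+ 2.
Proof.
move=> c0 FG Gx; have -> : (n%:R * (c * x)) ^+ 2 = c ^+ 2 * (n%:R * x) ^+ 2 by ring.
apply: le_trans (ler_wpM2l (sqr_ge0 c) Gx).
rewrite /frob mulr_sumr; apply: ler_sum => s _; rewrite mulr_sumr.
apply: ler_sum => t _; rewrite !mxE; case: eqVneq => [_|/FG].
  by rewrite expr0n mulr0.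
by rewrite -exprMn -ler_abs_sqr normrM (ger0_norm c0).
Qed.

(** The constants [c], [c'] are additive matrices and disappear. Bilinearity leaves the leading term
    and three others, (u, r'), (r, v) and (r, r'), which [Udot_le] bounds with factors 4, 4 and 16
    times 288; 5000 rounds up 16 * 288 = 4608. The bounds on the slopes [k], [k'] keep these factors
    from growing. *)
Lemma Udot_perturb (R : realType) (n : nat) (u v r r' : 'I_n -> 'I_n -> R)
    (F G : 'I_n -> 'I_n -> R) (c c' k k' a b g l : R) : (3 < n)%N ->
  (forall s t, s != t -> F s t = c + k * u s t + r s t) ->
  (forall s t, s != t -> G s t = c' + k' * v s t + r' s t) ->
  `|k| <= 1 -> `|k'| <= 1 ->
  (forall s t, s != t -> `|r s t| <= 4 * u s t ^+ 2) ->
  (forall s t, s != t -> `|r' s t| <= 4 * v s t ^+ 2) ->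
  0 <= a -> 0 <= b -> 0 <= g -> 0 <= l ->
  frob (offdiag_mx u) <= (n%:R * a) ^+ 2 ->
  frob (offdiag_mx v) <= (n%:R * b) ^+ 2 ->
  frob (offdiag_mx (fun s t => u s t ^+ 2)) <= (n%:R * g) ^+ 2 ->
  frob (offdiag_mx (fun s t => v s t ^+ 2)) <= (n%:R * l) ^+ 2 ->
  `|Udot (offdiag_mx F) (offdiag_mx G)
    - k * k' * Udot (offdiag_mx u) (offdiag_mx v)|
    <= 5000 * (a * l + g * b + g * l).
Proof.
move=> n3 HF HG k1 k1' Hr Hr' a0 b0 g0 l0 fu fv fg fl.
have n2 : (2 < n)%N by exact: ltnW.
pose F1 s t := k * u s t + r s t; pose G1 s t := k' * v s t + r' s t.
have EF : Ucenter (offdiag_mx F) = Ucenter (offdiag_mx F1).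
  apply: (@Ucenter_add_additive _ _ _ _ (fun=> c / 2)) => // s t st.
  by rewrite HF // /F1; field.
have EG : Ucenter (offdiag_mx G) = Ucenter (offdiag_mx G1).
  apply: (@Ucenter_add_additive _ _ _ _ (fun=> c' / 2)) => // s t st.
  by rewrite HG // /G1; field.
rewrite (eq_Udotl _ EF) UdotC (eq_Udotl _ EG) UdotC /F1 /G1.
rewrite !offdiag_mxD !offdiag_mxZ !UdotDl !UdotDr !UdotZl !UdotZr.
have fr : frob (offdiag_mx r) <= (n%:R * (4 * g)) ^+ 2.
  apply: frob_offdiag_le fg => // s t st.
  by rewrite (ger0_norm (sqr_ge0 _)) Hr.
have fr' : frob (offdiag_mx r') <= (n%:R * (4 * l)) ^+ 2.
  apply: frob_offdiag_le fl => // s t st.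
  by rewrite (ger0_norm (sqr_ge0 _)) Hr'.
have g40 : 0 <= 4 * g by rewrite mulr_ge0.
have l40 : 0 <= 4 * l by rewrite mulr_ge0.
have := Udot_le n3 a0 l40 fu fr'.
have := Udot_le n3 g40 b0 fr fv.
have := Udot_le n3 g40 l40 fr fr'.
set U := Udot _ _ => HU; set V := Udot _ _ => HV; set W := Udot _ _ => HW.
rewrite [X in `|X|](_ : _ = k * W + k' * V + U); last by rewrite -/U -/V -/W; ring.
apply: (@le_trans _ _ (`|W| + `|V| + `|U|)).
  apply: (le_trans (ler_normD _ _)); rewrite lerD2r.
  apply: (le_trans (ler_normD _ _)); rewrite !normrM.
  by apply: lerD; rewrite ler_piMl.
have := mulr_ge0 a0 l0; have := mulr_ge0 g0 b0; have := mulr_ge0 g0 l0.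
lra.
Qed.

(** * Second-order expansions of the square root and of the kernels *)

Lemma sqrt_one_plus_sub (R : realType) (x : R) : -1 <= x ->
  `|Num.sqrt (1 + x) - 1| <= `|x|.
Proof.
move=> x1; have h0 : 0 <= 1 + x by lra.
have := sqr_sqrtr h0; have := sqrtr_ge0 (1 + x).
set s := Num.sqrt _ => s0 s2.
have -> : x = (s - 1) * (s + 1) by rewrite -subr_sqr s2; ring.
by rewrite normrM ler_peMr // ger0_norm; lra.
Qed.

(** With s = sqrt (1 + x) the error is exactly - (s - 1)^2 / 2. The bound therefore reaches x = -1,
    where the square root is not differentiable, and the expansion of dCov holds without any
    smallness of the deviations. *)
Lemma sqrt_one_plus_taylor (R : realType) (x : R) : -1 <= x ->
  `|Num.sqrt (1 + x) - 1 - x / 2| <= x ^+ 2 / 2.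
Proof.
move=> x1; have h0 : 0 <= 1 + x by lra.
have := sqrt_one_plus_sub x1; have := sqr_sqrtr h0.
set s := Num.sqrt _ => s2 sx.
have -> : s - 1 - x / 2 = - ((s - 1) ^+ 2 / 2).
  have -> : x = s ^+ 2 - 1 by rewrite s2; ring.
  by field.
rewrite normrN ger0_norm; last by rewrite mulr_ge0 ?sqr_ge0 ?invr_ge0.
by rewrite ler_pM2r ?invr_gt0 // -ler_abs_sqr.
Qed.

(** Only exp y >= 1 + y is used, at y = -x and y = x. The first gives the sign; the second gives exp
    (-x) (1 + x) <= 1, so the error times 1 + x is at most x^2, and 1 + x >= 1/2. *)
Lemma expRN_taylor (R : realType) (x : R) : - 2^-1 <= x ->
  `|expR (- x) - 1 + x| <= 2 * x ^+ 2.
Proof.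
move=> x1; have h := expR_ge1Dx (- x); rewrite ger0_norm; last by lra.
have h' := expR_ge1Dx x.
have e1 : expR (- x) * expR x = 1 by rewrite mulrC expRxMexpNx_1.
have e0 := expR_gt0 (- x).
have k0 : expR (- x) * (1 + x) <= 1 by rewrite -[leRHS]e1 ler_pM2l.
have : (expR (- x) - 1 + x) * (1 + x) <= x ^+ 2 by nra.
set y := expR _ - 1 + x; have y0 : 0 <= y by rewrite /y; lra.
nra.
Qed.

Lemma derive1_gaussian_kernel (R : realType) (x : R) :
  derive1 (@gaussian_kernel R) x = - x * expR (- (x ^+ 2 / 2)).
Proof.
have H : is_derive x 1 (fun y : R => - (y ^+ 2 / 2)) (- x).
  have -> : (fun y : R => - (y ^+ 2 / 2)) = (- 2^-1) \*: (fun y : R => y ^+ 2).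
    by apply/funext => y /=; rewrite /GRing.scale /= mulrC mulNr; ring.
  by apply: is_derive_eq; rewrite /GRing.scale /=; field.
rewrite derive1E; apply: derive_val.
have := @is_derive1_comp R expR _ x _ _ (is_derive_expR (- (x ^+ 2 / 2))) H.
by rewrite mulrC.
Qed.

Lemma derive1_laplacian_kernel (R : realType) (x : R) :
  derive1 (@laplacian_kernel R) x = - expR (- x).
Proof.
rewrite derive1E; apply: derive_val.
have H : is_derive x 1 (fun y : R => - y) (- 1) by apply: is_derive_eq.
have := @is_derive1_comp R expR _ x _ _ (is_derive_expR (- x)) H.
by rewrite mulrN1.
Qed.

(** The quantity bounded is the derivative at L = 0 of f (r sqrt (1 + L)), that is, the slope for
    which [Udot_perturb] asks a bound by 1. The range of [r] is the one that the median allows in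
    [hCov2_expansion]. *)
Lemma kernel_deriv_bounds (R : realType) (f : R -> R) (r : R) :
  f = @gaussian_kernel R \/ f = @laplacian_kernel R ->
  0 < r -> r ^+ 2 <= 4 / 3 -> `|derive1 f r * r / 2| <= 1.
Proof.
move=> [->|->] r0 r2.
- rewrite derive1_gaussian_kernel.
  have e1 : expR (- (r ^+ 2 / 2)) <= 1 by rewrite -[leRHS]expR0 ler_expR; have := sqr_ge0 r; lra.
  have e0 := expR_ge0 (- (r ^+ 2 / 2)).
  have er : expR (- (r ^+ 2 / 2)) * r ^+ 2 <= r ^+ 2.
    by rewrite ler_piMl // sqr_ge0.
  have er0 : 0 <= expR (- (r ^+ 2 / 2)) * r ^+ 2 by rewrite mulr_ge0 // sqr_ge0.
  rewrite [X in `|X|](_ : _ = - (expR (- (r ^+ 2 / 2)) * r ^+ 2 / 2)); last by ring.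
  by rewrite ler_norml; apply/andP; split; lra.
- rewrite derive1_laplacian_kernel.
  have e1 : expR (- r) <= 1 by rewrite -[leRHS]expR0 ler_expR; lra.
  have e0 := expR_ge0 (- r).
  have r43 : r <= 4 / 3 by nra.
  have er : expR (- r) * r <= r by rewrite ler_piMl // ltW.
  have er0 : 0 <= expR (- r) * r by rewrite mulr_ge0 // ltW.
  by rewrite ler_norml; apply/andP; split; lra.
Qed.

(** For the Gaussian kernel the square root disappears: the value is f r times exp (-x) with x = r^2
    L / 2. For the Laplacian kernel it is f r times exp (-y) with y = r (sqrt (1 + L) - 1), and the
    errors 2 y^2 <= 8/3 L^2 of the exponential and r L^2 / 2 <= 2/3 L^2 of the root add up. The
    bound 1/4 on [L] keeps x and y above -1/2. *)
Lemma kernel_taylor (R : realType) (f : R -> R) (r L : R) :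
  f = @gaussian_kernel R \/ f = @laplacian_kernel R ->
  0 < r -> r ^+ 2 <= 4 / 3 -> `|L| <= 1 / 4 ->
  `|f (r * Num.sqrt (1 + L)) - f r - derive1 f r * r / 2 * L| <= 4 * L ^+ 2.
Proof.
move=> fE r0 r2 L1; have [L1l L1r] : - (1 / 4) <= L /\ L <= 1 / 4.
  by move: L1; rewrite ler_norml => /andP.
have L2 := sqr_ge0 L.
have LL : - 1 <= L by lra.
case: fE => ->.
- rewrite derive1_gaussian_kernel /gaussian_kernel.
  rewrite exprMn sqr_sqrtr; last by lra.
  set c := expR (- (r ^+ 2 / 2)); pose x := r ^+ 2 / 2 * L.
  have c1 : c <= 1 by rewrite /c -[leRHS]expR0 ler_expR; have := sqr_ge0 r; lra.
  have c0 : 0 <= c := expR_ge0 _.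
  have -> : - (r ^+ 2 * (1 + L) / 2) = - (r ^+ 2 / 2) + - x by rewrite /x; field.
  rewrite expRD -/c.
  have -> : c * expR (- x) - c - - r * c * r / 2 * L = c * (expR (- x) - 1 + x).
    by rewrite /x; field.
  rewrite normrM (ger0_norm c0).
  have x1 : - 2^-1 <= x by rewrite /x; nra.
  have := expRN_taylor x1 => H.
  apply: (@le_trans _ _ (2 * x ^+ 2)); first by apply: le_trans H; rewrite ler_piMl.
  have -> : x ^+ 2 = (r ^+ 2 / 2) ^+ 2 * L ^+ 2 by rewrite /x; ring.
  have : (r ^+ 2 / 2) ^+ 2 <= 1 by rewrite expr_le1 //; nra.
  nra.
- rewrite derive1_laplacian_kernel /laplacian_kernel.
  have HT := sqrt_one_plus_taylor LL; have HS := sqrt_one_plus_sub LL.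
  set s := Num.sqrt _ in HT HS *; pose y := r * (s - 1).
  have r43 : r <= 4 / 3 by nra.
  set c := expR (- r).
  have c1 : c <= 1 by rewrite /c -[leRHS]expR0 ler_expR; lra.
  have c0 : 0 <= c := expR_ge0 _.
  have -> : - (r * s) = - r + - y by rewrite /y; ring.
  rewrite expRD -/c.
  have -> : c * expR (- y) - c - - c * r / 2 * L =
    c * ((expR (- y) - 1 + y) - r * (s - 1 - L / 2)) by rewrite /y; field.
  rewrite normrM (ger0_norm c0).
  have HS' : `|s - 1| <= 1 / 4 by apply: le_trans HS _.
  have y1 : - 2^-1 <= y.
    by move: HS'; rewrite ler_norml => /andP[]; rewrite /y; nra.
  have H := expRN_taylor y1.
  have y2 : y ^+ 2 <= 4 / 3 * L ^+ 2.
    rewrite /y exprMn; apply: ler_pM; rewrite ?sqr_ge0 //.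
    by rewrite -ler_abs_sqr.
  apply: (@le_trans _ _ (`|expR (- y) - 1 + y - r * (s - 1 - L / 2)|)).
    by rewrite ler_piMl.
  apply: (le_trans (ler_normB _ _)); rewrite normrM (ger0_norm (ltW r0)).
  have := ler_wpM2l (ltW r0) HT; nra.
Qed.

(** * Relative deviations of squared distances and the median bandwidth *)

Lemma edist_ge0 (R : realType) (p : nat) (x y : p.-tuple R) : 0 <= edist x y.
Proof. exact: sqrtr_ge0. Qed.

Lemma edist_sqr (R : realType) (p : nat) (x y : p.-tuple R) :
  edist x y ^+ 2 = \sum_(i < p) (tnth x i - tnth y i) ^+ 2.
Proof. by rewrite sqr_sqrtr // sumr_ge0 // => i _; exact: sqr_ge0. Qed.

(** The L_st of the overview for one outcome of the sample, at a scale [T] that will be tau_X or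
    tau_Y; it has the same formula as [rel_dev]. *)
Definition sqdev (R : realType) (n p : nat) (x : 'I_n -> p.-tuple R) (T : R) s t : R :=
  (edist (x s) (x t) ^+ 2 - T ^+ 2) / T ^+ 2.

Lemma sqdev_geN1 (R : realType) (n p : nat) (x : 'I_n -> p.-tuple R) (T : R) s t :
  0 < T -> -1 <= sqdev x T s t.
Proof.
move=> T0; rewrite /sqdev ler_pdivlMr ?exprn_gt0 //.
have := sqr_ge0 (edist (x s) (x t)); lra.
Qed.

Lemma edist_sqdev (R : realType) (n p : nat) (x : 'I_n -> p.-tuple R) (T : R) s t :
  0 < T -> edist (x s) (x t) = T * Num.sqrt (1 + sqdev x T s t).
Proof.
move=> T0; rewrite -[LHS](ger0_norm (edist_ge0 _ _)) -sqrtr_sqr.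
rewrite -[X in _ = X * _](gtr0_norm T0) -sqrtr_sqr -sqrtrM ?sqr_ge0 //.
congr Num.sqrt; rewrite /sqdev; field; exact: lt0r_neq0.
Qed.

Lemma median_ge (R : realType) (s : seq R) (c : R) :
  (0 < size s)%N -> (forall z, z \in s -> c <= z) -> c <= median s.
Proof.
move=> s0 sc; rewrite /median /=.
have H k : (k < size s)%N -> c <= (sort <=%R s)`_k.
  by move=> ks; apply: sc; rewrite -(mem_sort <=%R) mem_nth // size_sort.
have h1 : ((size s)./2 < size s)%N by rewrite ltn_half_double -addnn -{1}(addn0 (size s)) ltn_add2l.
have h2 : ((size s).-1./2 < size s)%N.
  by apply: leq_ltn_trans h1; apply: half_leq; exact: leq_pred.
have := H _ h1; have := H _ h2; lra.
Qed.

Lemma median_dist_ge (R : realType) (n p : nat) (x : 'I_n -> p.-tuple R) (c : R) :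
  (1 < n)%N -> (forall s t, s != t -> c <= edist (x s) (x t)) -> c <= median_dist x.
Proof.
move=> n1 xc; apply: median_ge => [|z /mapP[[s t]]]; last first.
  by rewrite mem_enum => /= st ->; exact: xc.
rewrite size_map -has_predT; apply/hasP.
have n0 : (0 < n)%N by exact: ltnW.
exists (Ordinal n0, Ordinal n1) => //.
by rewrite mem_enum.
Qed.

Section Expansions.
Variables (R : realType) (n p q : nat).
Variables (x : 'I_n -> p.-tuple R) (y : 'I_n -> q.-tuple R) (tX tY a b g l : R).
Let u := sqdev x tX.
Let v := sqdev y tY.
Hypotheses (n3 : (3 < n)%N) (tX0 : 0 < tX) (tY0 : 0 < tY).
Hypotheses (a0 : 0 <= a) (b0 : 0 <= b) (g0 : 0 <= g) (l0 : 0 <= l).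
Hypothesis fu : frob (offdiag_mx u) <= (n%:R * a) ^+ 2.
Hypothesis fv : frob (offdiag_mx v) <= (n%:R * b) ^+ 2.
Hypothesis fg : frob (offdiag_mx (fun s t => u s t ^+ 2)) <= (n%:R * g) ^+ 2.
Hypothesis fl : frob (offdiag_mx (fun s t => v s t ^+ 2)) <= (n%:R * l) ^+ 2.

(** The scales factor out of the distances tX sqrt (1 + u) and tY sqrt (1 + v). Both slopes are then
    1/2, and their product is the 1/4 of the leading term. *)
Lemma dCov2_expansion :
  `|dCov2 x y - tX * tY / 4 * Udot (offdiag_mx u) (offdiag_mx v)|
    <= 5000 * (tX * tY * (a * l + g * b + g * l)).
Proof.
have E : dCov2 x y = tX * tY *
    Udot (offdiag_mx (fun s t => Num.sqrt (1 + u s t)))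
         (offdiag_mx (fun s t => Num.sqrt (1 + v s t))).
  rewrite /dCov2 (@eq_offdiag_mx _ _ _ (fun s t => tX * Num.sqrt (1 + u s t))).
    rewrite (@eq_offdiag_mx _ _ (fun s t => edist (y s) (y t))
      (fun s t => tY * Num.sqrt (1 + v s t))).
      by rewrite !offdiag_mxZ UdotZl UdotZr mulrA.
    by move=> s t _; exact: edist_sqdev.
  by move=> s t _; exact: edist_sqdev.
have rem (w : R) : -1 <= w -> `|Num.sqrt (1 + w) - 1 - w / 2| <= 4 * w ^+ 2.
  move=> w1; apply: le_trans (sqrt_one_plus_taylor w1) _.
  by have := sqr_ge0 w; lra.
have h12 : `|2^-1 : R| <= 1 by rewrite ger0_norm; lra.
have H := @Udot_perturb R n u v (fun s t => Num.sqrt (1 + u s t) - 1 - u s t / 2)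
  (fun s t => Num.sqrt (1 + v s t) - 1 - v s t / 2)
  (fun s t => Num.sqrt (1 + u s t)) (fun s t => Num.sqrt (1 + v s t))
  1 1 2^-1 2^-1 a b g l n3.
have {}H := H _ _ h12 h12 _ _ a0 b0 g0 l0 fu fv fg fl.
rewrite E.
set U1 := Udot _ _ in H *; set U2 := Udot _ _ in H *.
have t0 : 0 < tX * tY by rewrite mulr_gt0.
have -> : tX * tY * U1 - tX * tY / 4 * U2 = tX * tY * (U1 - 2^-1 * 2^-1 * U2) by field.
rewrite normrM (gtr0_norm t0) [leRHS]mulrCA ler_pM2l //; apply: H => s t _.
- ring.
- ring.
- by apply: rem; exact: sqdev_geN1.
- by apply: rem; exact: sqdev_geN1.
Qed.

(** For a fixed outcome the bandwidths are mere numbers, and [Udot_perturb] applies with slopes that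
    depend on them. The hypotheses on [u] and [v] serve both to bound the bandwidths below and to
    expand the kernels. *)
Lemma hCov2_expansion (f h : R -> R) :
  f = @gaussian_kernel R \/ f = @laplacian_kernel R ->
  h = @gaussian_kernel R \/ h = @laplacian_kernel R ->
  (forall s t, s != t -> `|u s t| <= 1 / 4) ->
  (forall s t, s != t -> `|v s t| <= 1 / 4) ->
  `|hCov2 f h x y - (derive1 f (tX / median_dist x) * (tX / median_dist x) / 2)
     * (derive1 h (tY / median_dist y) * (tY / median_dist y) / 2)
     * Udot (offdiag_mx u) (offdiag_mx v)|
    <= 5000 * (a * l + g * b + g * l).
Proof.
move=> hf hh u4 v4.
(* All squared distances are at least (1 - 1/4) T^2, hence so is the square of the median, and the
   ratio r = T / m satisfies r^2 <= 4/3. *)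
have med (k : nat) (z : 'I_n -> k.-tuple R) (T : R) : 0 < T ->
    (forall s t, s != t -> `|sqdev z T s t| <= 1 / 4) ->
    0 < T / median_dist z /\ (T / median_dist z) ^+ 2 <= 4 / 3.
  move=> T0 z4; set m := median_dist z.
  have mT : T * Num.sqrt (3 / 4) <= m.
    apply: median_dist_ge => [|s t st]; first by apply: leq_trans n3.
    rewrite (edist_sqdev z s t T0) ler_pM2l // ler_sqrt.
      by have := z4 _ _ st; rewrite ler_norml => /andP[]; lra.
    by have := z4 _ _ st; rewrite ler_norml => /andP[]; lra.
  have s34 : 0 < Num.sqrt (3 / 4 : R) by rewrite sqrtr_gt0; lra.
  have m0 : 0 < m by apply: lt_le_trans mT; rewrite mulr_gt0.
  have tm : T / m * Num.sqrt (3 / 4) <= 1.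
    by rewrite mulrAC ler_pdivrMr // mul1r.
  have r0 : 0 < T / m by rewrite divr_gt0.
  split=> //.
  have : (T / m * Num.sqrt (3 / 4)) ^+ 2 <= 1.
    by rewrite expr_le1 // mulr_ge0 // ltW.
  rewrite exprMn sqr_sqrtr; lra.
have [rx0 rx2] := med _ x tX tX0 u4; have [ry0 ry2] := med _ y tY tY0 v4.
set rx := tX / median_dist x in rx0 rx2 *; set ry := tY / median_dist y in ry0 ry2 *.
set k := derive1 f rx * rx / 2; set k' := derive1 h ry * ry / 2.
apply: (@Udot_perturb R n u v
  (fun s t => f (rx * Num.sqrt (1 + u s t)) - f rx - k * u s t)
  (fun s t => h (ry * Num.sqrt (1 + v s t)) - h ry - k' * v s t)
  _ _ (f rx) (h ry)) => //.
- move=> s t _; rewrite (edist_sqdev x s t tX0) mulrAC -/rx; ring.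
- move=> s t _; rewrite (edist_sqdev y s t tY0) mulrAC -/ry; ring.
- exact: kernel_deriv_bounds.
- exact: kernel_deriv_bounds.
- by move=> s t st; apply: kernel_taylor => //; exact: u4.
- by move=> s t st; apply: kernel_taylor => //; exact: v4.
Qed.

End Expansions.

(** * Laws of pairs and conditional centering *)

Section PairLaw.
Context (R : realType) (d d' d1 d2 : measure_display) (T : measurableType d)
  (T' : measurableType d') (E1 : measurableType d1) (E2 : measurableType d2)
  (P : probability T R) (P' : probability T' R)
  (U : T -> E1) (V : T -> E2) (U' : T' -> E1) (V' : T' -> E2).
Hypotheses (mU : measurable_fun setT U) (mV : measurable_fun setT V)
  (mU' : measurable_fun setT U') (mV' : measurable_fun setT V').
Hypothesis rect : forall A B, measurable A -> measurable B ->
  P (U @^-1` A `&` V @^-1` B) = P' (U' @^-1` A `&` V' @^-1` B).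

Let Z w := (U w, V w).
Let Z' w := (U' w, V' w).
Let mZ : measurable_fun setT Z. Proof. exact: measurable_fun_pair. Qed.
Let mZ' : measurable_fun setT Z'. Proof. exact: measurable_fun_pair. Qed.
Let z : {mfun T >-> (E1 * E2)%type} := HB.pack Z (isMeasurableFun.Build _ _ _ _ _ mZ).
Let z' : {mfun T' >-> (E1 * E2)%type} := HB.pack Z' (isMeasurableFun.Build _ _ _ _ _ mZ').

(** Rectangles form a pi-system that generates the product sigma-algebra. The two pairs may live on
    different probability spaces, which allows a pair of sample points to be compared with (X,
    X'). *)
Lemma pair_law_eq (C : set (E1 * E2)) : measurable C -> P (Z @^-1` C) = P' (Z' @^-1` C).
Proof.
move=> mC; pose G : set (set (E1 * E2)) :=
  [set C | exists A, measurable A /\ exists B, measurable B /\ C = A `*` B].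
apply: (@measure_unique _ R _ G (fun=> setT) _ _ _ _
  (pushforward P z) (pushforward P' z')) => //.
- rewrite measurable_prod_measurableType //; congr (<<s _ >>).
  rewrite predeqE; split => [[A mA [B mB <-]]|[A [mA [B [mB ->]]]]].
    by exists A; split => //; exists B.
  by exists A => //; exists B.
- move=> _ _ [X1 [mX1 [X2 [mX2 ->]]]] [Y1 [mY1 [Y2 [mY2 ->]]]].
  rewrite -setXI; exists (X1 `&` Y1); split; first exact: measurableI.
  by exists (X2 `&` Y2); split => //; exact: measurableI.
- by move=> _; exists setT; split => //; exists setT; split => //; rewrite setXTT.
- by rewrite bigcup_const //; exists 0%N.
- by move=> _ [A [mA [B [mB ->]]]]; exact: rect.
- move=> _; rewrite -[X in (X < _)%E]/(P (Z @^-1` setT)) preimage_setT.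
  by rewrite probability_setT ltry.
Qed.

Lemma pair_integral_eq (F : E1 * E2 -> \bar R) (C : set (E1 * E2)) :
  measurable C -> measurable_fun setT F -> (forall e, 0 <= F e)%E ->
  (\int[P]_(w in Z @^-1` C) F (U w, V w) = \int[P']_(w in Z' @^-1` C) F (U' w, V' w))%E.
Proof.
move=> mC mF F0.
rewrite -(@ge0_integral_pushforward _ _ _ _ R Z mZ P C F) //; last first.
  exact: measurable_funTS.
rewrite -(@ge0_integral_pushforward _ _ _ _ R Z' mZ' P' C F) //; last first.
  exact: measurable_funTS.
apply: (@eq_measure_integral _ _ R C (pushforward P' z') (pushforward P z)).
by move=> A mA _; exact: pair_law_eq.
Qed.

End PairLaw.

Lemma mutually_independent_pair (R : realType) (d dE : measure_display)
    (T : measurableType d) (E : measurableType dE) (P : probability T R)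
    (I : finType) (Z : I -> T -> E) (s t : I) (A B : set E) :
  mutually_independent P Z -> s != t -> measurable A -> measurable B ->
  P (Z s @^-1` A `&` Z t @^-1` B) = (P (Z s @^-1` A) * P (Z t @^-1` B))%E.
Proof.
move=> ind st mA mB; have ts : (t == s) = false by rewrite eq_sym (negPf st).
have := ind [set s; t]%SET (fun i => if i == s then A else B).
rewrite big_setU1 ?inE //= big_set1 eqxx ts => <-; last by move=> i; case: ifP.
congr (P _); apply/seteqP; split => w /=.
  by move=> [wA wB] i /=; rewrite !inE => /orP[]/eqP->; rewrite ?eqxx ?ts.
by move=> H; have := H s; have := H t; rewrite /= !inE !eqxx ts orbT /=; split; auto.
Qed.

Section ConditionalCentering.
Context (R : realType) (d : measure_display) (T : measurableType d)
  (P : probability T R).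

(** Integrals over events of the sigma-algebra of [U] depend only on the joint law, so both sides
    have the same set of candidate versions. [cond_exp] chooses from this set alone, hence it
    returns the same function, also when the set is empty. *)
Lemma cond_exp_same_law (k : R -> R -> R) (U V V' : T -> R) :
  measurable_fun setT U -> measurable_fun setT V -> measurable_fun setT V' ->
  (forall A B, measurable A -> measurable B ->
    P (U @^-1` A `&` V @^-1` B) = P (U @^-1` A `&` V' @^-1` B)) ->
  measurable_fun setT (fun e : R * R => k e.1 e.2) -> (forall a b, 0 <= k a b) ->
  cond_exp P (fun w => k (U w) (V w)) U = cond_exp P (fun w => k (U w) (V' w)) U.
Proof.
move=> mU mV mV' rect mk k0; rewrite /cond_exp; congr xget.
apply/funext => C; apply/propext.
have H A : g_sigma_algebra_preimage U A ->
    (\int[P]_(w in A) (k (U w) (V w))%:E = \int[P]_(w in A) (k (U w) (V' w))%:E)%E.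
  move=> [B mB <-]; rewrite setTI.
  (* An event of the sigma-algebra of [U] is the preimage under the pair of a rectangle unrestricted
     in its second side. *)
  have := @pair_integral_eq R _ _ _ _ T T _ _ P P U V U V' mU mV mU mV' rect
    (fun e => (k e.1 e.2)%:E) (B `*` setT).
  rewrite (_ : (fun w => (U w, V w)) @^-1` (B `*` setT) = U @^-1` B); last first.
    by apply/seteqP; split => w //= [].
  rewrite (_ : (fun w => (U w, V' w)) @^-1` (B `*` setT) = U @^-1` B); last first.
    by apply/seteqP; split => w //= [].
  apply; [exact: measurableX|exact/measurable_EFinP|].
  by move=> e; rewrite lee_fin.
by split=> -[mC iC HC]; split=> // A mA; rewrite HC // H.
Qed.

Variables (n : nat) (U : 'I_n -> T -> R) (m : set R -> \bar R) (k : R -> R -> R).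
Hypothesis mU : forall s, measurable_fun setT (U s).
Hypothesis indep : forall s t A B, s != t -> measurable A -> measurable B ->
  P (U s @^-1` A `&` U t @^-1` B) = (m A * m B)%E.
Hypothesis mk : measurable_fun setT (fun e : R * R => k e.1 e.2).
Hypothesis k0 : forall a b, 0 <= k a b.
Hypothesis kC : forall a b, k a b = k b a.

(** The conditional expectation given [U s] is one function [phi s], whatever the partner t, so it
    can be defined from any partner [o s] other than s; two indices are enough for that. Symmetry of
    [k] takes care of conditioning on the second variable, and the common mean [c] is shared equally
    between the two indices. *)
Lemma dcentered_additive : (1 < n)%N ->
  exists h : T -> 'I_n -> R, forall w s t, s != t ->
    dcentered P k (U s) (U t) w = k (U s w) (U t w) + (h w s + h w t).
Proof.
move=> n1; have n0 : (0 < n)%N by exact: ltnW.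
pose i0 := Ordinal n0; pose i1 := Ordinal n1.
pose o s := if s == i0 then i1 else i0.
have os s : s != o s by rewrite /o; have [E|//] := eqVneq s i0; rewrite E.
pose phi s := cond_exp P (fun w => k (U s w) (U (o s) w)) (U s).
have phiE s t : s != t -> cond_exp P (fun w => k (U s w) (U t w)) (U s) = phi s.
  move=> st; apply: cond_exp_same_law => // A B mA mB.
  by rewrite !indep.
have phiE' s t : s != t -> cond_exp P (fun w => k (U s w) (U t w)) (U t) = phi t.
  rewrite eq_sym => /phiE <-; congr cond_exp.
  by apply/funext => w; rewrite kC.
pose c := fine 'E_P[fun w => k (U i0 w) (U i1 w)]%E.
have cE s t : s != t -> fine 'E_P[fun w => k (U s w) (U t w)]%E = c.
  move=> st; rewrite /c unlock; congr fine.
  have rect A B : measurable A -> measurable B ->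
      P (U s @^-1` A `&` U t @^-1` B) = P (U i0 @^-1` A `&` U i1 @^-1` B).
    by move=> mA mB; rewrite !indep.
  have := @pair_integral_eq R _ _ _ _ T T _ _ P P (U s) (U t) (U i0) (U i1)
    (mU s) (mU t) (mU i0) (mU i1) rect (fun e => (k e.1 e.2)%:E) setT measurableT.
  rewrite !preimage_setT => -> //; last by move=> e; rewrite lee_fin.
  exact/measurable_EFinP.
exists (fun w s => c / 2 - phi s w) => w s t st.
by rewrite /dcentered phiE // phiE' // cE //; field.
Qed.

End ConditionalCentering.

(** * uCov as a sum of U-centered products *)

Section UCov.
Context (R : realType) (d : measure_display) (T : measurableType d)
  (P : probability T R) (n p q : nat).
Variables (X : 'I_n -> T -> p.-tuple R) (Y : 'I_n -> T -> q.-tuple R).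
Variables (mX : 'I_p -> set R -> \bar R) (mY : 'I_q -> set R -> \bar R).
Hypothesis measX : forall s i, measurable_fun setT (fun w => tnth (X s w) i).
Hypothesis measY : forall s j, measurable_fun setT (fun w => tnth (Y s w) j).
Hypothesis indX : forall i s t A B, s != t -> measurable A -> measurable B ->
  P ((fun w => tnth (X s w) i) @^-1` A `&` (fun w => tnth (X t w) i) @^-1` B)
  = (mX i A * mX i B)%E.
Hypothesis indY : forall i s t A B, s != t -> measurable A -> measurable B ->
  P ((fun w => tnth (Y s w) i) @^-1` A `&` (fun w => tnth (Y t w) i) @^-1` B)
  = (mY i A * mY i B)%E.
Hypothesis n2 : (2 < n)%N.

(* U-centering removes the conditional expectations, for every outcome and
   not only almost surely: the versions chosen by [cond_exp] for the pairs
   (s, t) and (s, t') are the same function. *)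
Lemma uCov2E (k l : R -> R -> R) w :
  measurable_fun setT (fun e : R * R => k e.1 e.2) ->
  measurable_fun setT (fun e : R * R => l e.1 e.2) ->
  (forall a b, 0 <= k a b) -> (forall a b, 0 <= l a b) ->
  (forall a b, k a b = k b a) -> (forall a b, l a b = l b a) ->
  uCov2 P k l X Y w = (Num.sqrt (p%:R * q%:R))^-1 * \sum_(i < p) \sum_(j < q)
    Udot (offdiag_mx (fun s t => k (tnth (X s w) i) (tnth (X t w) i)))
         (offdiag_mx (fun s t => l (tnth (Y s w) j) (tnth (Y t w) j))).
Proof.
move=> mk ml k0 l0 kC lC; congr *%R; apply: eq_bigr => i _; apply: eq_bigr => j _.
have n1 : (1 < n)%N by exact: ltnW.
have [h hE] := dcentered_additive (measX ^~ i) (@indX i) mk k0 kC n1.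
have [h' hE'] := dcentered_additive (measY ^~ j) (@indY j) ml l0 lC n1.
rewrite (eq_Udotl _ (Ucenter_add_additive n2 (hE w))) UdotC.
by rewrite (eq_Udotl _ (Ucenter_add_additive n2 (hE' w))) UdotC.
Qed.

Lemma measurable_abs_kernel : measurable_fun setT (fun e : R * R => abs_kernel e.1 e.2).
Proof.
apply: measurableT_comp; first exact: normr_measurable.
by apply: measurable_funB; [exact: measurable_fst|exact: measurable_snd].
Qed.

Lemma measurable_sq_kernel : measurable_fun setT (fun e : R * R => sq_kernel e.1 e.2).
Proof. by apply: measurable_funX; exact: measurable_abs_kernel. Qed.

Lemma mdCov2E w :
  mdCov2 (fun s => X s w) (fun s => Y s w) =
  Num.sqrt (p%:R * q%:R) * Num.sqrt ('C(n, 2))%:R *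
    uCov2 P (@abs_kernel R) (@abs_kernel R) X Y w.
Proof.
rewrite uCov2E //; do ?[exact: measurable_abs_kernel | by move=> a b; exact: normr_ge0
  | by move=> a b; exact: distrC].
(* If p or q is 0, then sqrt (pq) and its inverse are both 0 and do not cancel; the two sides are
   equal because the sums are empty. *)
have [p0|p0] := posnP p.
  by rewrite /mdCov2 !big1 ?mulr0 // => -[i hi]; exfalso; move: hi; rewrite p0.
have [q0|q0] := posnP q.
  rewrite /mdCov2 !big1 ?mulr0 // => i _;
  by rewrite big1 // => -[j hj]; exfalso; move: hj; rewrite q0.
have sq : Num.sqrt (p%:R * q%:R : R) != 0.
  by rewrite sqrtr_eq0 -ltNge -natrM ltr0n muln_gt0 p0.
by rewrite mulrA [_ * _ * _^-1]mulrAC divff // mul1r.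
Qed.

Lemma uCov2_sq_kernel (tX tY : R) w : 0 < tX -> 0 < tY ->
  uCov2 P (@sq_kernel R) (@sq_kernel R) X Y w =
  (tX * tY) ^+ 2 / Num.sqrt (p%:R * q%:R) *
    Udot (offdiag_mx (sqdev (fun s => X s w) tX)) (offdiag_mx (sqdev (fun s => Y s w) tY)).
Proof.
move=> tX0 tY0.
rewrite uCov2E //; do ?[exact: measurable_sq_kernel | by move=> a b; rewrite sqr_ge0
  | by move=> a b; rewrite /sq_kernel distrC].
have E (r : nat) (Z : 'I_n -> r.-tuple R) t : 0 < t ->
    Ucenter (\sum_i offdiag_mx (fun s t => sq_kernel (tnth (Z s) i) (tnth (Z t) i)))
    = Ucenter (t ^+ 2 *: offdiag_mx (sqdev Z t)).
  move=> t0; have -> : \sum_i offdiag_mx (fun s t => sq_kernel (tnth (Z s) i) (tnth (Z t) i))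
      = offdiag_mx (fun s t => edist (Z s) (Z t) ^+ 2).
    apply/matrixP => s s'; rewrite summxE mxE edist_sqr.
    have [->|ss'] := eqVneq s s'.
      by rewrite big1 // => i _; rewrite mxE eqxx.
    by apply: eq_bigr => i _; rewrite mxE (negPf ss') /sq_kernel real_normK ?num_real.
  rewrite -offdiag_mxZ; apply: (@Ucenter_add_additive _ _ _ _ (fun=> t ^+ 2 / 2)) => // s s' _.
  by rewrite /sqdev; field; exact: lt0r_neq0.
set S := \sum_i _; have -> : S =
   Udot (\sum_i offdiag_mx (fun s t => sq_kernel (tnth (X s w) i) (tnth (X t w) i)))
    (\sum_i offdiag_mx (fun s t => sq_kernel (tnth (Y s w) i) (tnth (Y t w) i))).
  rewrite Udot_suml; apply: eq_bigr => i _; rewrite Udot_sumr; exact: eq_bigr.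
rewrite (eq_Udotl _ (E _ (fun s => X s w) _ tX0)) UdotC.
rewrite (eq_Udotl _ (E _ (fun s => Y s w) _ tY0)) UdotC UdotZl UdotZr; ring.
Qed.

End UCov.

(** * Measurability *)

Section Measurability.
Context (R : realType) (d : measure_display) (T : measurableType d).

Lemma measurable_sqrt : measurable_fun setT (@Num.sqrt R).
Proof. by apply: nondecreasing_measurable => // x y; exact: ler_wsqrtr. Qed.

(** Off 0 the inverse is x times the power -1 of x^2, and at 0 both expressions are 0. *)
Lemma measurable_inv : measurable_fun setT (fun x : R => x^-1).
Proof.
have -> : (fun x : R => x^-1) = (fun x => x * powR (x ^+ 2) (-1)).
  apply/funext => x; rewrite powR_inv1 ?sqr_ge0 //.
  have [->|x0] := eqVneq x 0; first by rewrite invr0 mul0r.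
  by field.
apply: measurable_funM => //.
apply: (@measurableT_comp _ _ _ _ _ _ (fun y : R => powR y (-1))) => //.
Qed.

Lemma measurable_fun_inv (f : T -> R) :
  measurable_fun setT f -> measurable_fun setT (fun w => (f w)^-1).
Proof. by move=> mf; apply: measurableT_comp mf; exact: measurable_inv. Qed.

Lemma measurable_Ucenter (n : nat) (A : T -> 'M[R]_n) :
  (forall s t, measurable_fun setT (fun w => A w s t)) ->
  forall s t, measurable_fun setT (fun w => Ucenter (A w) s t).
Proof.
move=> mA s t; rewrite /Ucenter; under eq_fun do rewrite mxE.
case: eqP => _; first exact: measurable_cst.
apply: measurable_funD; first apply: measurable_funB; first apply: measurable_funB => //.
- by apply: measurable_funM => //; apply: measurable_sum.
- by apply: measurable_funM => //; apply: measurable_sum.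
- by apply: measurable_funM => //; apply: measurable_sum => u; apply: measurable_sum.
Qed.

Lemma measurable_Udot (n : nat) (A B : T -> 'M[R]_n) :
  (forall s t, measurable_fun setT (fun w => A w s t)) ->
  (forall s t, measurable_fun setT (fun w => B w s t)) ->
  measurable_fun setT (fun w => Udot (A w) (B w)).
Proof.
move=> mA mB; apply: measurable_funM => //; apply: measurable_sum => s.
under eq_fun do rewrite big_mkcond; apply: measurable_sum => t.
have [_|_] := boolP (s != t) => //.
by apply: measurable_funM; exact: measurable_Ucenter.
Qed.

Lemma measurable_offdiag (n : nat) (F : T -> 'I_n -> 'I_n -> R) :
  (forall s t, measurable_fun setT (fun w => F w s t)) ->
  forall s t, measurable_fun setT (fun w => offdiag_mx (F w) s t).
Proof.
move=> mF s t; under eq_fun do rewrite mxE.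
by case: eqP => _; [exact: measurable_cst|exact: mF].
Qed.

Lemma measurable_count_le (I : Type) (r : seq I) (F : I -> T -> R) (x : R) :
  (forall i, measurable_fun setT (F i)) ->
  measurable_fun setT (fun w => count (<= x) [seq F i w | i <- r]).
Proof.
move=> mF; elim: r => [|i r IH] /=; first exact: measurable_cst.
apply: measurable_fun_addn => //.
rewrite (_ : (fun w => _) = (fun w => if F i w <= x then 1%N else 0%N)).
  apply: measurable_fun_ifT => //; exact: measurable_fun_ler.
by apply/funext => w; case: ifP.
Qed.

(** The entry of rank k, counted from 0, exceeds x exactly when at most k of the values are <= x; so
    half-lines pull back to conditions on a measurable count. Beyond the end of the list the value
    is the default 0. *)
Lemma measurable_sort_nth (I : Type) (r : seq I) (F : I -> T -> R) (k : nat) :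
  (forall i, measurable_fun setT (F i)) ->
  measurable_fun setT (fun w => (sort <=%R [seq F i w | i <- r])`_k).
Proof.
move=> mF; have [rk|kr] := leqP (size r) k.
  under eq_fun do rewrite nth_default ?size_sort ?size_map //.
  exact: measurable_cst.
move=> _; apply: (measurability _ (RGenOInfty.measurableE R)) => //.
move=> _ [_ [x ->] <-]; rewrite setTI.
rewrite [X in measurable X](_ : _ =
    [set w | count (<= x) [seq F i w | i <- r] <= k]%N); last first.
  apply/seteqP; split => w /=; rewrite in_itv /= andbT;
    set s := map _ _; have ss : sorted <=%R (sort <=%R s) by exact: sort_le_sorted.
    rewrite leqNgt; apply: contraL => ck; rewrite -leNgt.
    by apply: nth_count_le ss _; rewrite (permP (permEl (perm_sort _ _))).
  move=> ck; apply: nth_count_gt ss _.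
  by rewrite (permP (permEl (perm_sort _ _))) ck size_sort size_map.
have := measurable_fun_leq (measurable_count_le r x mF)
  (@measurable_cst _ _ T _ setT k).
by move=> /(_ measurableT [set true] Logic.I); rewrite setTI preimage_true.
Qed.

Lemma measurable_median (I : Type) (r : seq I) (F : I -> T -> R) :
  (forall i, measurable_fun setT (F i)) ->
  measurable_fun setT (fun w => median [seq F i w | i <- r]).
Proof.
move=> mF; rewrite /median; under eq_fun do rewrite size_map.
by apply: measurable_funM => //; apply: measurable_funD; exact: measurable_sort_nth.
Qed.

Lemma measurable_edist (p : nat) (Z Z' : T -> p.-tuple R) :
  (forall i, measurable_fun setT (fun w => tnth (Z w) i)) ->
  (forall i, measurable_fun setT (fun w => tnth (Z' w) i)) ->
  measurable_fun setT (fun w => edist (Z w) (Z' w)).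
Proof.
move=> mZ mZ'; apply: measurableT_comp; first exact: measurable_sqrt.
by apply: measurable_sum => i; apply: measurable_funX; exact: measurable_funB.
Qed.

Lemma measurable_median_dist (n p : nat) (X : T -> 'I_n -> p.-tuple R) :
  (forall s i, measurable_fun setT (fun w => tnth (X w s) i)) ->
  measurable_fun setT (fun w => median_dist (X w)).
Proof.
move=> mX; apply: (@measurable_median _ _ (fun st w => edist (X w st.1) (X w st.2))).
by move=> st; exact: measurable_edist.
Qed.

Lemma measurable_dCov2 (n p q : nat) (X : T -> 'I_n -> p.-tuple R)
    (Y : T -> 'I_n -> q.-tuple R) :
  (forall s i, measurable_fun setT (fun w => tnth (X w s) i)) ->
  (forall s i, measurable_fun setT (fun w => tnth (Y w s) i)) ->
  measurable_fun setT (fun w => dCov2 (X w) (Y w)).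
Proof.
by move=> mX mY; apply: measurable_Udot; apply: measurable_offdiag => s t;
  exact: measurable_edist.
Qed.

Lemma measurable_kernel (f : R -> R) :
  f = @gaussian_kernel R \/ f = @laplacian_kernel R -> measurable_fun setT f.
Proof.
move=> [->|->]; apply: measurableT_comp; try exact: measurable_expR.
  by apply: measurable_funN; apply: measurable_funM => //; exact: exprn_measurable.
exact: measurable_funN.
Qed.

Lemma measurable_derive1_kernel (f : R -> R) :
  f = @gaussian_kernel R \/ f = @laplacian_kernel R ->
  measurable_fun setT (fun x => derive1 f x : R).
Proof.
move=> fE; case: (fE) => fE'.
  have -> : (fun x => derive1 f x : R) = (fun x => - x * f x).
    by apply/funext => x; rewrite fE' derive1_gaussian_kernel.
  apply: measurable_funM; last exact: measurable_kernel.
  exact: measurable_funN.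
have -> : (fun x => derive1 f x : R) = (fun x => - f x).
  by apply/funext => x; rewrite fE' derive1_laplacian_kernel.
by apply: measurable_funN; exact: measurable_kernel.
Qed.

Lemma measurable_hCov2 (f g : R -> R) (n p q : nat) (X : T -> 'I_n -> p.-tuple R)
    (Y : T -> 'I_n -> q.-tuple R) :
  measurable_fun setT f -> measurable_fun setT g ->
  (forall s i, measurable_fun setT (fun w => tnth (X w s) i)) ->
  (forall s i, measurable_fun setT (fun w => tnth (Y w s) i)) ->
  measurable_fun setT (fun w => hCov2 f g (X w) (Y w)).
Proof.
move=> mf mg mX mY; apply: measurable_Udot; apply: measurable_offdiag => s t;
  apply: measurableT_comp => //; apply: measurable_funM;
  do ?[exact: measurable_edist]; apply: measurable_fun_inv;
  exact: measurable_median_dist.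
Qed.

Lemma measurable_sqdev (n p : nat) (X : T -> 'I_n -> p.-tuple R) (t : R) s s' :
  (forall s i, measurable_fun setT (fun w => tnth (X w s) i)) ->
  measurable_fun setT (fun w => sqdev (X w) t s s').
Proof.
move=> mX; apply: measurable_funM => //; apply: measurable_funB => //.
by apply: measurable_funX; exact: measurable_edist.
Qed.

Lemma measurable_frob (n : nat) (A : T -> 'M[R]_n) :
  (forall s t, measurable_fun setT (fun w => A w s t)) ->
  measurable_fun setT (fun w => frob (A w)).
Proof.
move=> mA; apply: measurable_sum => s; apply: measurable_sum => t.
exact: measurable_funX.
Qed.

Variable P : probability T R.

(** Markov's inequality in multiples of a bound [m] on the mean. The event is strict, so the case m
    = 0 is included: [Z] then vanishes almost everywhere and the event is null. This case occurs
    when one of the moments alpha, ..., lambda is 0. *)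
Lemma markov_gt (Z : T -> R) (m K : R) :
  measurable_fun setT Z -> (forall w, 0 <= Z w) -> 0 < K -> 0 <= m ->
  (\int[P]_w (Z w)%:E <= m%:E)%E ->
  (P [set w | (K * m < Z w)%R] <= (K^-1)%:E)%E.
Proof.
move=> mZ Z0 K0 m0 Zm.
have mA c : measurable [set w | (c < Z w)%R].
  have := measurable_fun_ltr (@measurable_cst _ _ T _ setT c) mZ.
  by move=> /(_ measurableT [set true] I); rewrite setTI preimage_true.
have mZE : measurable_fun setT (EFin \o Z) by exact/measurable_EFinP.
have M c : (0 <= c)%R -> (c%:E * P [set w | (c < Z w)%R] <= m%:E)%E.
  move=> c0; apply: le_trans Zm; rewrite -integral_cst //.
  apply: (@le_trans _ _ (\int[P]_(w in [set w | (c < Z w)%R]) (Z w)%:E)%E).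
    apply: ge0_le_integral => //=.
    - exact: measurable_funTS.
    - by move=> w; rewrite lee_fin => /ltW.
  by apply: ge0_subset_integral => // w _; rewrite lee_fin.
have [m_gt0|m_le0] := ltP 0%R m.
  have := M _ (mulr_ge0 (ltW K0) (ltW m_gt0)).
  rewrite muleC -lee_pdivlMr ?mulr_gt0 //.
  rewrite -EFinM; congr (_ <= _%:E)%E; field; by rewrite !gt_eqF.
have m00 : m = 0 by apply/le_anti; rewrite m0 m_le0.
rewrite m00 mulr0; apply: (@le_trans _ _ 0%E); last by rewrite lee_fin invr_ge0 ltW.
have I0 : (\int[P]_w `|(Z w)%:E| = 0)%E.
  under eq_integral do rewrite gee0_abs ?lee_fin //.
  apply/le_anti; rewrite integral_ge0 ?andbT; last by move=> w _; rewrite lee_fin.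
  by move: Zm; rewrite m00.
move/(ae_eq_integral_abs P measurableT mZE): I0 => [N [mN N0 sub]].
rewrite -N0; apply: le_measure; rewrite ?inE //.
by move=> w /= Zw; apply: sub => /= /(_ I)[] /eqP; rewrite gt_eqF.
Qed.

End Measurability.

(** * Moments and probability bounds *)

Section CopyMoments.
Context (R : realType) (d : measure_display) (T : measurableType d) (P : probability T R).

Lemma Lfun2_of_sqr (U : T -> R) (b : R) : measurable_fun setT U ->
  ('E_P[fun w => (U w ^+ 2)%R] <= b%:E)%E -> U \in Lfun P 2%:E.
Proof.
move=> mU Ub; rewrite inE; apply/andP; split; first by rewrite inE.
rewrite inE /= /finite_norm unlock poweR_lty //.
apply: le_lt_trans (ltry b); apply: le_trans Ub; rewrite unlock.
rewrite le_eqVlt; apply/orP; left; apply/eqP; apply: eq_integral => w _ /=.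
by rewrite powR_mulrn // real_normK // num_real.
Qed.

(** The right side is the variance of x - U, which equals that of U, plus the square of its mean. *)
Lemma variance_le_sqr_sub (U : T -> R) (x : R) : U \in Lfun P 2%:E ->
  ('V_P[U] <= 'E_P[fun w => ((x - U w) ^+ 2)%R])%E.
Proof.
move=> U2; have V2 : (cst x \- U)%R \in Lfun P 2%:E.
  rewrite -[(cst x \- U)%R]/(cst x - U)%R rpredB ?lee1n // => h; exact: Lfun_cst.
rewrite -(varianceB_cst_l x U2) varianceE //.
rewrite (_ : ((cst x \- U) ^+ 2)%R = fun w => ((x - U w) ^+ 2)%R); last first.
  by apply/funext => w; rewrite !expr2.
have fE : 'E_P[(cst x \- U)%R]%E \is a fin_num.
  by rewrite expectation_fin_num // Lfun_subset12 ?fin_num_measure.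
by rewrite -(fineK fE) -EFin_expe leeBlDr // leeDl // lee_fin sqr_ge0.
Qed.

Variables (U U' : T -> R) (b : R).
Hypotheses (mU : measurable_fun setT U) (mU' : measurable_fun setT U').
Hypothesis copy : independent_copy P U U'.
Hypothesis Ub : ('E_P[fun w => (U w ^+ 2)%R] <= b%:E)%E.

Lemma copy_sqr_sub_le : ('E_P[fun w => ((U w - U' w) ^+ 2)%R] <= (4 * b)%:E)%E.
Proof.
have U'b : ('E_P[fun w => (U' w ^+ 2)%R] = 'E_P[fun w => (U w ^+ 2)%R])%E.
  have := @pair_integral_eq R _ _ _ _ T T _ _ P P U' U' U U mU' mU' mU mU _
    (fun e => (e.1 ^+ 2)%:E) setT measurableT.
  rewrite !preimage_setT unlock => -> //.
  - move=> A B mA mB; case: copy => law _.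
    by have := law _ (measurableI _ _ mA mB); rewrite !preimage_setI.
  - by apply/measurable_EFinP; apply: measurable_funX; exact: measurable_fst.
  - by move=> e; rewrite lee_fin sqr_ge0.
have mS (W : T -> R) : measurable_fun setT W ->
    measurable_fun setT (fun w => (2 * W w ^+ 2)%:E).
  by move=> mW; apply/measurable_EFinP; apply: measurable_funM => //; exact: measurable_funX.
have mSq (W : T -> R) : measurable_fun setT W ->
    measurable_fun setT (fun w => (W w ^+ 2)%:E).
  by move=> mW; apply/measurable_EFinP; exact: measurable_funX.
apply: (@le_trans _ _ (\int[P]_w ((2 * U w ^+ 2)%:E + (2 * U' w ^+ 2)%:E))%E).
  rewrite unlock; apply: ge0_le_integral => //=.
  - by move=> w _; rewrite lee_fin sqr_ge0.
  - by apply: mSq; exact: measurable_funB.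
  - by apply: emeasurable_funD; exact: mS.
  - move=> w _; rewrite -EFinD lee_fin.
    by have := sqr_ge0 (U w + U' w); rewrite sqrrB sqrrD; lra.
rewrite ge0_integralD //=; do ?[exact: mS | by move=> w _; rewrite lee_fin mulr_ge0 ?sqr_ge0].
have H (W : T -> R) : measurable_fun setT W ->
    ('E_P[fun w => (W w ^+ 2)%R] <= b%:E)%E -> (\int[P]_w (2 * W w ^+ 2)%:E <= (2 * b)%:E)%E.
  move=> mW Wb; under eq_integral do rewrite EFinM.
  rewrite ge0_integralZl_EFin //; last 2 first.
  - by move=> w _; rewrite lee_fin sqr_ge0.
  - exact: mSq.
  by rewrite EFinM lee_pmul2l //; move: Wb; rewrite unlock.
rewrite (_ : 4 * b = 2 * b + 2 * b); last by ring.
by rewrite EFinD leeD // H // U'b.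
Qed.

(** The joint law of (U, U') is the square of the law of U. By Tonelli the right side is an average
    over x of E (x - U)^2, and each of these is at least the variance. The exact value is twice the
    variance; one suffices for tau > 0. *)
Lemma variance_le_copy_sqr_sub : ('V_P[U] <= 'E_P[fun w => ((U w - U' w) ^+ 2)%R])%E.
Proof.
pose u : {mfun T >-> R} := HB.pack U (isMeasurableFun.Build _ _ _ _ _ mU).
pose mu : probability R R := distribution P u.
pose Q : probability (R * R)%type R := (mu \x mu)%E.
have mF : measurable_fun setT (fun e : R * R => ((e.1 - e.2) ^+ 2)%:E).
  apply/measurable_EFinP; apply: measurable_funX; apply: measurable_funB.
    exact: measurable_fst.
  exact: measurable_snd.
have rect (A B : set R) : measurable A -> measurable B ->
    P (U @^-1` A `&` U' @^-1` B) = Q (fst @^-1` A `&` snd @^-1` B).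
  move=> mA mB; case: copy => law ind; rewrite ind // law //.
  rewrite (_ : fst @^-1` A `&` snd @^-1` B = A `*` B); last by apply/seteqP; split.
  by rewrite /Q /= product_measure1E.
have := @pair_integral_eq R _ _ _ _ T _ _ _ P Q U U' fst snd mU mU'
  measurable_fst measurable_snd rect _ setT measurableT mF.
rewrite !preimage_setT [in X in _ -> X]unlock => -> //; last first.
  by move=> e; rewrite lee_fin sqr_ge0.
rewrite (eq_integral (fun e : R * R => ((e.1 - e.2) ^+ 2)%:E)) //.
rewrite fubini_tonelli1 //=; last by move=> e; rewrite lee_fin sqr_ge0.
have U2 := Lfun2_of_sqr mU Ub.
apply: (@le_trans _ _ (\int[mu]_x 'V_P[U])%E).
  by rewrite integral_cst // [X in (_ * X)%E](probability_setT mu) mule1.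
apply: ge0_le_integral => //.
- by move=> x _; exact: variance_ge0.
- by apply: measurable_fun_fubini_tonelli_F => // e; rewrite lee_fin sqr_ge0.
move=> x _; apply: le_trans (variance_le_sqr_sub x U2) _.
rewrite /fubini_F unlock /= ge0_integral_distribution //=.
- apply/measurable_EFinP; apply: measurable_funX; exact: measurable_funB.
- by move=> y; rewrite lee_fin sqr_ge0.
Qed.

End CopyMoments.

Lemma rms_dist_bounds (R : realType) (d : measure_display) (T : measurableType d)
    (P : probability T R) (p : nat) (Z Z' : T -> p.-tuple R) (a b : R) :
  (forall i, measurable_fun setT (fun w => tnth (Z w) i)) ->
  (forall i, measurable_fun setT (fun w => tnth (Z' w) i)) ->
  (forall i, independent_copy P (fun w => tnth (Z w) i) (fun w => tnth (Z' w) i)) ->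
  (forall i, (a%:E <= 'V_P[fun w => tnth (Z w) i])%E /\
    ('E_P[fun w => (tnth (Z w) i ^+ 2)%R] <= b%:E)%E) ->
  0 < a -> (0 < p)%N ->
  0 < rms_dist P Z Z' /\ rms_dist P Z Z' ^+ 2 <= 4 * b * p%:R.
Proof.
move=> mZ mZ' copy ab a0 p0; rewrite /rms_dist.
set e := 'E_P[_]%E.
have mS i : measurable_fun setT (fun w => ((tnth (Z w) i - tnth (Z' w) i) ^+ 2)%:E).
  by apply/measurable_EFinP; apply: measurable_funX; exact: measurable_funB.
have eE : (e = \sum_(i < p) 'E_P[fun w => ((tnth (Z w) i - tnth (Z' w) i) ^+ 2)%R])%E.
  rewrite /e unlock; under eq_integral do rewrite edist_sqr -sumEFin.
  by rewrite ge0_integral_sum // => i w _; rewrite lee_fin sqr_ge0.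
have e1 : ((a * p%:R)%:E <= e)%E.
  rewrite eE; have -> : a * p%:R = \sum_(i < p) a.
    by rewrite sumr_const card_ord mulr_natr.
  rewrite -sumEFin; apply: lee_sum => i _; apply: le_trans (ab i).1 _.
  by apply: (@variance_le_copy_sqr_sub _ _ _ _ _ _ b) => //; exact: (ab i).2.
have e2 : (e <= (4 * b * p%:R)%:E)%E.
  rewrite eE; have -> : 4 * b * p%:R = \sum_(i < p) (4 * b).
    by rewrite sumr_const card_ord mulr_natr.
  rewrite -sumEFin; apply: lee_sum => i _.
  by apply: copy_sqr_sub_le => //; exact: (ab i).2.
have ap : 0 < a * p%:R by rewrite mulr_gt0 ?ltr0n.
(* The two bounds exclude infinite values of the expectation, so [fine] returns its true value. *)
move: e e1 e2 {eE} => [r|//|//]; rewrite !lee_fin /= => r1 r2.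
have r0 : 0 < r by apply: lt_le_trans r1.
by rewrite sqrtr_gt0 r0 sqr_sqrtr // ltW.
Qed.

(** * Markov bounds for matrices built on pairs of sample points *)

Section PairStatistics.
Context (R : realType) (d d' : measure_display) (T : measurableType d)
  (T' : measurableType d') (P : probability T R) (P' : probability T' R) (n p : nat).
Variables (Zs : 'I_n -> T' -> p.-tuple R) (Z Z' : T -> p.-tuple R).
Hypotheses (mZs : forall s, measurable_fun setT (Zs s))
  (mZ : measurable_fun setT Z) (mZ' : measurable_fun setT Z').
Hypothesis rect : forall s t A B, s != t -> measurable A -> measurable B ->
  P' (Zs s @^-1` A `&` Zs t @^-1` B) = P (Z @^-1` A `&` Z' @^-1` B).

(** Each off-diagonal entry has the law of [G Z Z'], hence second moment [c]; the zero diagonal is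
    also counted at [c], to reach n^2. *)
Lemma frob_mean (G : p.-tuple R -> p.-tuple R -> R) (c : R) :
  measurable_fun setT (fun e : p.-tuple R * p.-tuple R => G e.1 e.2) ->
  ('E_P[fun w => (G (Z w) (Z' w) ^+ 2)%R] = c%:E)%E ->
  (\int[P']_w (frob (offdiag_mx (fun s t => G (Zs s w) (Zs t w))))%:E
    <= (n%:R ^+ 2 * c)%:E)%E.
Proof.
move=> mG Gc.
have mGs s t : measurable_fun setT (fun w => G (Zs s w) (Zs t w)).
  have := measurableT_comp mG (measurable_fun_pair (mZs s) (mZs t)).
  exact.
have mO := measurable_offdiag mGs.
have c0 : 0 <= c by rewrite -lee_fin -Gc; apply: expectation_ge0 => w; exact: sqr_ge0.
rewrite /frob; under eq_integral do rewrite -sumEFin.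
rewrite ge0_integral_sum //; last 2 first.
- move=> s; apply/measurable_EFinP; apply: measurable_sum => t.
  exact: measurable_funX.
- by move=> s w _; rewrite lee_fin sumr_ge0 // => t _; exact: sqr_ge0.
have -> : n%:R ^+ 2 * c = \sum_(s < n) \sum_(t < n) c.
  by rewrite !sumr_const !card_ord -mulrnA -[RHS]mulr_natl natrM expr2.
rewrite -sumEFin; apply: lee_sum => s _.
under eq_integral do rewrite -sumEFin.
rewrite ge0_integral_sum //; last 2 first.
- by move=> t; apply/measurable_EFinP; exact: measurable_funX.
- by move=> t w _; rewrite lee_fin sqr_ge0.
rewrite -sumEFin; apply: lee_sum => t _.
have [st|st] := eqVneq s t.
  under eq_integral do rewrite mxE st eqxx expr0n /=.
  by rewrite integral0 lee_fin.
under eq_integral do rewrite mxE (negPf st).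
have mF : measurable_fun setT (fun e : p.-tuple R * p.-tuple R => (G e.1 e.2 ^+ 2)%:E).
  by apply/measurable_EFinP; exact: measurable_funX.
have := @pair_integral_eq R _ _ _ _ T' T _ _ P' P (Zs s) (Zs t) Z Z'
  (mZs s) (mZs t) mZ mZ' (fun A B => rect st) _ setT measurableT mF.
rewrite !preimage_setT => -> //; last by move=> e; rewrite lee_fin sqr_ge0.
by move: Gc; rewrite unlock => <-.
Qed.

Lemma frob_tail (G : p.-tuple R -> p.-tuple R -> R) (x K : R) :
  measurable_fun setT (fun e : p.-tuple R * p.-tuple R => G e.1 e.2) ->
  ('E_P[fun w => (G (Z w) (Z' w) ^+ 2)%R] = (x ^+ 2)%:E)%E -> 0 < K ->
  let B := [set w | ((n%:R * (K * x)) ^+ 2 <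
    frob (offdiag_mx (fun s t => G (Zs s w) (Zs t w))))%R] in
  measurable B /\ (P' B <= (K ^- 2)%:E)%E.
Proof.
move=> mG Gx K0 B.
have mGs s t : measurable_fun setT (fun w => G (Zs s w) (Zs t w)).
  have := measurableT_comp mG (measurable_fun_pair (mZs s) (mZs t)).
  exact.
have mf := measurable_frob (measurable_offdiag mGs).
split.
  have := measurable_fun_ltr (@measurable_cst _ _ T' _ setT ((n%:R * (K * x)) ^+ 2)) mf.
  by move=> /(_ measurableT [set true] I); rewrite setTI preimage_true.
have E : (n%:R * (K * x)) ^+ 2 = K ^+ 2 * (n%:R ^+ 2 * x ^+ 2) by ring.
rewrite /B E; apply: markov_gt mf _ _ _ _.
- by move=> w; exact: frob_ge0.
- by rewrite exprn_gt0.
- by rewrite mulr_ge0 ?sqr_ge0.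
- exact: frob_mean.
Qed.

End PairStatistics.

(** * From exceptional events to stochastic orders *)

Section BoundedInProbability.
Context (R : realType) (d : nat -> measure_display) (T : forall k, measurableType (d k))
  (P : forall k, probability (T k) R).
Variables (Z : forall k, T k -> R) (r : nat -> R).
Hypothesis mZ : \forall k \near \oo, measurable_fun setT (@Z k).

(** The hypothesis has the shape of [sample_bounds]. For a tolerance e, the choice K = 2 / sqrt e
    makes 4 / K^2 = e, and M = C K^2 does not depend on k. *)
Lemma bigO_p_of_tails (C : R) :
  (forall K : R, 0 < K -> \forall k \near \oo, exists B : set (T k),
    [/\ measurable B, (P k B <= (4 * K ^- 2)%:E)%E &
       forall w, ~ B w -> `|Z w| <= C * K ^+ 2 * r k]) ->
  is_bigO_p P Z r.
Proof.
move=> H e e0; pose K := 2 / Num.sqrt e.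
have se0 : 0 < Num.sqrt e by rewrite sqrtr_gt0.
have K0 : 0 < K by rewrite divr_gt0.
have Ke : 4 * K ^- 2 = e.
  rewrite /K -[e in RHS](sqr_sqrtr (ltW e0)); field.
  by rewrite gt_eqF.
exists (C * K ^+ 2).
near=> k.
have [B [mB PB HB]] : exists B : set (T k),
    [/\ measurable B, (P k B <= (4 * K ^- 2)%:E)%E &
       forall w, ~ B w -> `|Z w| <= C * K ^+ 2 * r k].
  by near: k; exact: H.
have mZk : measurable_fun setT (@Z k) by near: k.
rewrite -Ke; apply: le_trans PB; apply: le_measure; rewrite ?inE //.
  have := measurable_fun_ltr (@measurable_cst _ _ (T k) _ setT (C * K ^+ 2 * r k))
    (measurableT_comp (@normr_measurable R setT) mZk).
  by move=> /(_ measurableT [set true] I); rewrite setTI preimage_true.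
move=> w /= Mw; apply: contrapT => /HB; rewrite leNgt => /negP; exact.
Unshelve. all: by end_near.
Qed.

Lemma littleo_p1_of_bigO_p : is_bigO_p P Z r -> r @ \oo --> (0 : R) ->
  is_littleo_p1 P Z.
Proof.
move=> HO r0 e e0.
have mA c k : measurable_fun setT (@Z k) -> measurable [set w : T k | (c < `|Z w|)%R].
  move=> mZk; have := measurable_fun_ltr (@measurable_cst _ _ (T k) _ setT c)
    (measurableT_comp (@normr_measurable R setT) mZk).
  by move=> /(_ measurableT [set true] I); rewrite setTI preimage_true.
apply/fine_cvgP; split.
  near=> k; rewrite fin_num_measure //; apply: mA.
  by near: k.
apply/cvgrPdist_le => eps eps0.
have [M HM] := HO _ eps0.
have Mr0 : (fun k => M * r k) @ \oo --> (0 : R).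
  by rewrite -[X in _ --> X](mulr0 M); apply: cvgM; [exact: cvg_cst|exact: r0].
near=> k.
have mZk : measurable_fun setT (@Z k) by near: k.
have PM : (P k [set w | (M * r k < `|Z w|)%R] <= eps%:E)%E by near: k.
have Me : `|M * r k| < e by near: k; exact: (cvgr0_norm_lt _ Mr0).
rewrite sub0r normrN /=.
have fP : P k [set w | (e < `|Z w|)%R] \is a fin_num by rewrite fin_num_measure //; exact: mA.
rewrite ger0_norm; last by rewrite fine_ge0.
rewrite -lee_fin fineK //; apply: le_trans PM.
apply: le_measure; rewrite ?inE; try exact: mA.
by move=> w /=; apply: lt_trans; apply: le_lt_trans Me; exact: ler_norm.
Unshelve. all: by end_near.
Qed.

End BoundedInProbability.

(** * The sample *)

Section Transfer.
Context (R : realType) (d d' dE dF : measure_display) (T : measurableType d)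
  (T' : measurableType d') (E : measurableType dE) (F : measurableType dF)
  (P : probability T R) (P' : probability T' R) (I : finType).
Variables (Z Z' : T -> E) (Zs : I -> T' -> E) (h : E -> F).
Hypothesis mh : measurable_fun setT h.

Let mpre A : measurable A -> measurable (h @^-1` A).
Proof. by move=> mA; rewrite -[X in measurable X]setTI; exact: mh. Qed.

Lemma independent_copy_comp : independent_copy P Z Z' ->
  independent_copy P (h \o Z) (h \o Z').
Proof.
move=> [law ind]; split=> [A mA|A B mA mB].
  exact: law (mpre mA).
exact: ind (mpre mA) (mpre mB).
Qed.

Lemma iid_copies_pair : iid_copies P P' Z Zs -> forall s t A B, s != t ->
  measurable A -> measurable B ->
  P' ((h \o Zs s) @^-1` A `&` (h \o Zs t) @^-1` B) =
  (P ((h \o Z) @^-1` A) * P ((h \o Z) @^-1` B))%E.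
Proof.
move=> [ind law] s t A B st mA mB.
have := mutually_independent_pair ind st (mpre mA) (mpre mB).
by rewrite (law s _ (mpre mA)) (law t _ (mpre mB)).
Qed.

(** On rectangles both pair laws are the product of the law of [h \o Z] with itself; this is the
    hypothesis under which integrals are transferred from (Z, Z') to the sample. *)
Lemma iid_copies_rect : independent_copy P Z Z' -> iid_copies P P' Z Zs ->
  forall s t A B, s != t -> measurable A -> measurable B ->
  P' ((h \o Zs s) @^-1` A `&` (h \o Zs t) @^-1` B) =
  P ((h \o Z) @^-1` A `&` (h \o Z') @^-1` B).
Proof.
move=> /independent_copy_comp[law ind] iid s t A B st mA mB.
by rewrite iid_copies_pair // ind // law.
Qed.

End Transfer.

(** This passage from a Frobenius bound to a uniform one is where n alpha -> 0 and n beta -> 0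
    enter: with c = n K alpha all deviations become small at once. *)
Lemma frob_entry_le (R : realType) (n : nat) (F : 'I_n -> 'I_n -> R) (c : R) :
  0 <= c -> frob (offdiag_mx F) <= c ^+ 2 -> forall s t, s != t -> `|F s t| <= c.
Proof.
move=> c0 fc s t st; rewrite -(ger0_norm c0) ler_abs_sqr; apply: le_trans fc.
rewrite /frob (bigD1 s) //= (bigD1 t) //= mxE (negPf st) -addrA lerDl addr_ge0 //.
  by apply: sumr_ge0 => i _; exact: sqr_ge0.
by apply: sumr_ge0 => i _; apply: sumr_ge0 => j _; exact: sqr_ge0.
Qed.

Section Sample.
Context (R : realType) (n p q : nat).
Context (d dS : measure_display) (T : measurableType d) (P : probability T R)
  (TS : measurableType dS) (PS : probability TS R).
Variables (XY XY' : {RV P >-> (p.-tuple R * q.-tuple R)%type})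
  (S : 'I_n -> {RV PS >-> (p.-tuple R * q.-tuple R)%type}).
Hypothesis hcopy : independent_copy P XY XY'.
Hypothesis hiid : iid_copies P PS XY
  (fun s => S s : TS -> (p.-tuple R * q.-tuple R)%type).
Variables (a b a' b' : R).
Hypotheses (ha : 0 < a) (ha' : 0 < a').
Hypothesis hX : forall i : 'I_p, (a%:E <= 'V_P[fun w => tnth (XY w).1 i])%E /\
  ('E_P[fun w => ((tnth (XY w).1 i) ^+ 2)%R] <= b%:E)%E.
Hypothesis hY : forall j : 'I_q, (a'%:E <= 'V_P[fun w => tnth (XY w).2 j])%E /\
  ('E_P[fun w => ((tnth (XY w).2 j) ^+ 2)%R] <= b'%:E)%E.
Variables (f g : R -> R).
Hypothesis hf : f = @gaussian_kernel R \/ f = @laplacian_kernel R.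
Hypothesis hg : g = @gaussian_kernel R \/ g = @laplacian_kernel R.

Let X (w : TS) (s : 'I_n) : p.-tuple R := (S s w).1.
Let Y (w : TS) (s : 'I_n) : q.-tuple R := (S s w).2.
Let uCov (k : R -> R -> R) : TS -> R :=
  uCov2 PS k k (fun s w => X w s) (fun s w => Y w s).
Let tX := rms_dist P (fun w => (XY w).1) (fun w => (XY' w).1).
Let tY := rms_dist P (fun w => (XY w).2) (fun w => (XY' w).2).

Definition dCov_remainder (w : TS) : R :=
  dCov2 (X w) (Y w)
  - 4^-1 * (Num.sqrt (p%:R * q%:R) / (tX * tY)) * uCov (@sq_kernel R) w.

Definition hCov_remainder (w : TS) : R :=
  tX * tY * hCov2 f g (X w) (Y w)
  - Num.sqrt (p%:R * q%:R) / (4 * median_dist (X w) * median_dist (Y w))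
    * derive1 f (tX / median_dist (X w)) * derive1 g (tY / median_dist (Y w))
    * uCov (@sq_kernel R) w.

Let mtX i : measurable_fun setT (fun z : p.-tuple R * q.-tuple R => tnth z.1 i).
Proof. exact: measurableT_comp (measurable_tnth i) measurable_fst. Qed.

Let mtY i : measurable_fun setT (fun z : p.-tuple R * q.-tuple R => tnth z.2 i).
Proof. exact: measurableT_comp (measurable_tnth i) measurable_snd. Qed.

Let mS s : measurable_fun setT (S s : TS -> _). Proof. exact: measurable_funPT. Qed.
Let mXY : measurable_fun setT (XY : T -> _). Proof. exact: measurable_funPT. Qed.
Let mXY' : measurable_fun setT (XY' : T -> _). Proof. exact: measurable_funPT. Qed.

Let mX s i : measurable_fun setT (fun w => tnth (X w s) i).
Proof. exact: measurableT_comp (mtX i) (mS s). Qed.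

Let mY s i : measurable_fun setT (fun w => tnth (Y w s) i).
Proof. exact: measurableT_comp (mtY i) (mS s). Qed.

Lemma sample_mdCov2E w : (2 < n)%N ->
  mdCov2 (X w) (Y w) = Num.sqrt (p%:R * q%:R) * Num.sqrt ('C(n, 2))%:R *
    uCov (@abs_kernel R) w.
Proof.
move=> n2; exact: (mdCov2E mX mY (fun i => iid_copies_pair (mtX i) hiid)
  (fun i => iid_copies_pair (mtY i) hiid) n2 w).
Qed.

Let tX_bounds : (0 < p)%N -> 0 < tX /\ tX ^+ 2 <= 4 * b * p%:R.
Proof.
move=> p0; apply: (@rms_dist_bounds _ _ _ _ _ _ _ a b) => //.
- by move=> i; exact: measurableT_comp (mtX i) mXY.
- by move=> i; exact: measurableT_comp (mtX i) mXY'.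
- by move=> i; exact: (independent_copy_comp (mtX i) hcopy).
Qed.

Let tY_bounds : (0 < q)%N -> 0 < tY /\ tY ^+ 2 <= 4 * b' * q%:R.
Proof.
move=> q0; apply: (@rms_dist_bounds _ _ _ _ _ _ _ a' b') => //.
- by move=> i; exact: measurableT_comp (mtY i) mXY.
- by move=> i; exact: measurableT_comp (mtY i) mXY'.
- by move=> i; exact: (independent_copy_comp (mtY i) hcopy).
Qed.

Let uCovE w : (2 < n)%N -> (0 < p)%N -> (0 < q)%N ->
  uCov (@sq_kernel R) w = (tX * tY) ^+ 2 / Num.sqrt (p%:R * q%:R) *
    Udot (offdiag_mx (sqdev (X w) tX)) (offdiag_mx (sqdev (Y w) tY)).
Proof.
move=> n2 p0 q0.
exact: (uCov2_sq_kernel mX mY (fun i => iid_copies_pair (mtX i) hiid)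
  (fun i => iid_copies_pair (mtY i) hiid) n2 w (tX_bounds p0).1 (tY_bounds q0).1).
Qed.

(** By [uCovE] the chosen conditional expectations drop out, and an explicit expression in the
    sample remains. *)
Lemma measurable_uCov : (2 < n)%N -> (0 < p)%N -> (0 < q)%N ->
  measurable_fun setT (uCov (@sq_kernel R)).
Proof.
move=> n2 p0 q0; rewrite (funext (fun w => uCovE w n2 p0 q0)).
apply: measurable_funM => //; apply: measurable_Udot; apply: measurable_offdiag => s t;
  exact: measurable_sqdev.
Qed.

Lemma measurable_dCov_remainder : (2 < n)%N -> (0 < p)%N -> (0 < q)%N ->
  measurable_fun setT dCov_remainder.
Proof.
move=> n2 p0 q0; apply: measurable_funB; first exact: measurable_dCov2.
by apply: measurable_funM => //; exact: measurable_uCov.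
Qed.

Lemma measurable_hCov_remainder : (2 < n)%N -> (0 < p)%N -> (0 < q)%N ->
  measurable_fun setT hCov_remainder.
Proof.
move=> n2 p0 q0; apply: measurable_funB.
  by apply: measurable_funM => //; apply: measurable_hCov2 => //; exact: measurable_kernel.
have mmX := measurable_median_dist mX; have mmY := measurable_median_dist mY.
have mr (h : R -> R) (m : TS -> R) (t : R) :
    h = @gaussian_kernel R \/ h = @laplacian_kernel R -> measurable_fun setT m ->
    measurable_fun setT (fun w => derive1 h (t / m w) : R).
  move=> hh mm; apply: measurableT_comp (measurable_derive1_kernel hh) _.
  by apply: measurable_funM => //; exact: measurable_fun_inv.
apply: measurable_funM; last exact: measurable_uCov.
apply: measurable_funM; last exact: mr.
apply: measurable_funM; last exact: mr.
apply: measurable_funM => //; apply: measurable_fun_inv.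
by apply: measurable_funM => //; apply: measurable_funM.
Qed.

Variables (al be ga la : R).
Hypotheses (al0 : 0 <= al) (be0 : 0 <= be) (ga0 : 0 <= ga) (la0 : 0 <= la).
Let LX := rel_dev P (fun w => (XY w).1) (fun w => (XY' w).1).
Let LY := rel_dev P (fun w => (XY w).2) (fun w => (XY' w).2).
Hypothesis Eal : ('E_P[fun w => (LX w ^+ 2)%R] = (al ^+ 2)%:E)%E.
Hypothesis Ebe : ('E_P[fun w => (LY w ^+ 2)%R] = (be ^+ 2)%:E)%E.
Hypothesis Ega : ('E_P[fun w => (LX w ^+ 4)%R] = (ga ^+ 2)%:E)%E.
Hypothesis Ela : ('E_P[fun w => (LY w ^+ 4)%R] = (la ^+ 2)%:E)%E.

Let reldev (r : nat) (t : R) (z z' : r.-tuple R) := (edist z z' ^+ 2 - t ^+ 2) / t ^+ 2.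

Let measurable_reldev (r : nat) (t : R) :
  measurable_fun setT (fun e : r.-tuple R * r.-tuple R => reldev t e.1 e.2).
Proof.
apply: measurable_funM => //; apply: measurable_funB => //; apply: measurable_funX.
apply: measurable_edist => i.
  exact: measurableT_comp (measurable_tnth i) measurable_fst.
exact: measurableT_comp (measurable_tnth i) measurable_snd.
Qed.

(** The exceptional set is a union of four Markov events, one for each moment, of probability at
    most 1 / K^2 each; whence 4 / K^2. *)
Lemma sample_event (K : R) : 0 < K -> exists B : set TS,
  [/\ measurable B, (PS B <= (4 * K ^- 2)%:E)%E &
    forall w, ~ B w ->
      [/\ frob (offdiag_mx (sqdev (X w) tX)) <= (n%:R * (K * al)) ^+ 2,
          frob (offdiag_mx (sqdev (Y w) tY)) <= (n%:R * (K * be)) ^+ 2,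
          frob (offdiag_mx (fun s t => sqdev (X w) tX s t ^+ 2))
            <= (n%:R * (K * ga)) ^+ 2 &
          frob (offdiag_mx (fun s t => sqdev (Y w) tY s t ^+ 2))
            <= (n%:R * (K * la)) ^+ 2]].
Proof.
move=> K0.
have mfS s : measurable_fun setT (fst \o S s) by exact: measurableT_comp measurable_fst (mS s).
have msS s : measurable_fun setT (snd \o S s) by exact: measurableT_comp measurable_snd (mS s).
have rX := iid_copies_rect measurable_fst hcopy hiid.
have rY := iid_copies_rect measurable_snd hcopy hiid.
have mf1 := measurableT_comp measurable_fst mXY.
have mf2 := measurableT_comp measurable_fst mXY'.
have ms1 := measurableT_comp measurable_snd mXY.
have ms2 := measurableT_comp measurable_snd mXY'.
have [m1 P1] := frob_tail (G := reldev tX) mfS mf1 mf2 rX (measurable_reldev tX) Eal K0.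
have [m2 P2] := frob_tail (G := reldev tY) msS ms1 ms2 rY (measurable_reldev tY) Ebe K0.
(* The fourth moments are second moments of L^2, so the same tail bound applies with the matrix of
   squares. *)
have Ega' : ('E_P[fun w => ((LX w ^+ 2) ^+ 2)%R] = (ga ^+ 2)%:E)%E.
  by rewrite -Ega; congr expectation; apply/funext => w; rewrite -exprM.
have Ela' : ('E_P[fun w => ((LY w ^+ 2) ^+ 2)%R] = (la ^+ 2)%:E)%E.
  by rewrite -Ela; congr expectation; apply/funext => w; rewrite -exprM.
have [m3 P3] := frob_tail (G := fun z z' => reldev tX z z' ^+ 2)
  mfS mf1 mf2 rX (measurable_funX 2 (measurable_reldev tX)) Ega' K0.
have [m4 P4] := frob_tail (G := fun z z' => reldev tY z z' ^+ 2)
  msS ms1 ms2 rY (measurable_funX 2 (measurable_reldev tY)) Ela' K0.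
move: m1 P1 m2 P2 m3 P3 m4 P4.
set B1 := [set w | _]; set B2 := [set w | _]; set B3 := [set w | _]; set B4 := [set w | _].
move=> m1 P1 m2 P2 m3 P3 m4 P4.
exists ((B1 `|` B2) `|` (B3 `|` B4)); split.
- by apply: measurableU; exact: measurableU.
- have -> : 4 * K ^- 2 = (K ^- 2 + K ^- 2) + (K ^- 2 + K ^- 2) by ring.
  rewrite !EFinD; apply: le_trans (measureU2 _ _ _) _; try exact: measurableU.
  by apply: leeD; (apply: le_trans (measureU2 _ _ _) _; [by []|by []|exact: leeD]).
- move=> w; rewrite !not_orE /B1 /B2 /B3 /B4 /= => -[[/negP h1 /negP h2] [/negP h3 /negP h4]].
  by split; rewrite leNgt.
Qed.

Let tau := tX * tY.
Let rate := tau * al * la + tau * ga * be + tau * ga * la.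

(** Off the exceptional set the expansions apply with radii K alpha, ..., K lambda, and each product
    of two radii yields K^2. The bound for hCov carries smallness conditions that depend on K; they
    hold eventually for each fixed K, which is all that O_p asks. *)
Lemma sample_bounds (K : R) : (3 < n)%N -> (0 < p)%N -> (0 < q)%N -> 0 < K ->
  exists B : set TS, [/\ measurable B, (PS B <= (4 * K ^- 2)%:E)%E &
    forall w, ~ B w ->
      [/\ `|uCov (@sq_kernel R) w|
            <= 288 * Num.sqrt (16 * b * b') * K ^+ 2 * (tau * al * be),
          `|dCov_remainder w| <= 5000 * K ^+ 2 * rate &
          n%:R * (K * al) <= 1 / 4 -> n%:R * (K * be) <= 1 / 4 ->
          `|hCov_remainder w| <= 5000 * K ^+ 2 * rate]].
Proof.
move=> n3 p0 q0 K0; have n2 : (2 < n)%N by exact: ltnW.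
have [B [mB PB HB]] := sample_event K0; exists B; split => // w /HB[h1 h2 h3 h4].
have [tX0 tXb] := tX_bounds p0; have [tY0 tYb] := tY_bounds q0.
have tau0 : 0 < tau by rewrite mulr_gt0.
have pq : 0 < p%:R * q%:R :> R by rewrite mulr_gt0 ?ltr0n.
have sq0 : 0 < Num.sqrt (p%:R * q%:R : R) by rewrite sqrtr_gt0.
have [Kal Kbe] : 0 <= K * al /\ 0 <= K * be by rewrite !mulr_ge0 // ltW.
have [Kga Kla] : 0 <= K * ga /\ 0 <= K * la by rewrite !mulr_ge0 // ltW.
have R0 : 0 <= K * al * (K * la) + K * ga * (K * be) + K * ga * (K * la).
  by rewrite !addr_ge0 // mulr_ge0.
split.
- rewrite uCovE // normrM -/tau.
  have HU := Udot_le n3 Kal Kbe h1 h2.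
  (* From tau_X^2 <= 4 b p and tau_Y^2 <= 4 b' q. Their product also shows that 16 b b' is
     nonnegative, as is needed to split the root. *)
  have ts : tau / Num.sqrt (p%:R * q%:R) <= Num.sqrt (16 * b * b').
    rewrite ler_pdivrMr // -sqrtrM; last first.
      by rewrite -(pmulr_lge0 _ pq); apply: le_trans (mulr_ge0 (sqr_ge0 tX) (sqr_ge0 tY)) _;
        apply: le_trans (ler_pM (sqr_ge0 _) (sqr_ge0 _) tXb tYb) _; rewrite le_eqVlt;
        apply/orP; left; apply/eqP; ring.
    rewrite -[tau](ger0_norm (ltW tau0)) -sqrtr_sqr ler_wsqrtr // /tau exprMn.
    apply: le_trans (ler_pM (sqr_ge0 _) (sqr_ge0 _) tXb tYb) _.
    by rewrite le_eqVlt; apply/orP; left; apply/eqP; ring.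
  rewrite ger0_norm; last by rewrite divr_ge0 ?sqr_ge0 // ltW.
  apply: le_trans (ler_wpM2l _ HU) _; first by rewrite divr_ge0 ?sqr_ge0 // ltW.
  rewrite (_ : tau ^+ 2 / _ * _ =
    tau / Num.sqrt (p%:R * q%:R) * (288 * K ^+ 2 * (tau * al * be))); last by ring.
  rewrite (_ : 288 * _ * _ * _ =
    Num.sqrt (16 * b * b') * (288 * K ^+ 2 * (tau * al * be))); last by ring.
  apply: ler_wpM2r => //.
  by rewrite !mulr_ge0 // ltW.
- have := dCov2_expansion n3 tX0 tY0 Kal Kbe Kga Kla h1 h2 h3 h4.
  rewrite /dCov_remainder uCovE // (_ : 4^-1 * _ * _ = tX * tY / 4 *
    Udot (offdiag_mx (sqdev (X w) tX)) (offdiag_mx (sqdev (Y w) tY))).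
    by move/le_trans; apply; rewrite /rate /tau le_eqVlt; apply/orP; left; apply/eqP; ring.
  by field; rewrite !lt0r_neq0.
- move=> c1 c2.
  have u4 s t : s != t -> `|sqdev (X w) tX s t| <= 1 / 4.
    move=> st; apply: le_trans c1; apply: frob_entry_le st => //.
    by rewrite mulr_ge0.
  have v4 s t : s != t -> `|sqdev (Y w) tY s t| <= 1 / 4.
    move=> st; apply: le_trans c2; apply: frob_entry_le st => //.
    by rewrite mulr_ge0.
  have := hCov2_expansion n3 tX0 tY0 Kal Kbe Kga Kla h1 h2 h3 h4 hf hg u4 v4.
  set mx := median_dist _; set my := median_dist _.
  move=> H; rewrite /hCov_remainder uCovE // -/mx -/my.
  set U := Udot _ _ in H *; set h := hCov2 _ _ _ _ in H *.
  rewrite (_ : _ - _ = tau * (h - derive1 f (tX / mx) * (tX / mx) / 2 *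
    (derive1 g (tY / my) * (tY / my) / 2) * U)).
    rewrite normrM (gtr0_norm tau0); apply: le_trans (ler_wpM2l (ltW tau0) H) _.
    by rewrite /rate le_eqVlt; apply/orP; left; apply/eqP; ring.
  set s := Num.sqrt _; have s0 : s != 0 by rewrite lt0r_neq0.
  set df := derive1 f _; set dg := derive1 g _.
  have -> : (4 * mx * my)^-1 = 4^-1 * mx^-1 * my^-1 by rewrite !invfM.
  (* The inverted medians are generalized: [field] would ask that the medians be nonzero. *)
  by rewrite /tau; move: mx^-1 my^-1 df dg => i j df dg; field.
Qed.

End Sample.

Theorem proposition3p2p2 (R : realType)
  (* the pair (X, Y) = XY p q and its independent copy (X', Y') = XY' p q *)
  (d : nat -> nat -> measure_display)
  (T : forall p q : nat, measurableType (d p q))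
  (P : forall p q : nat, probability (T p q) R)
  (XY XY' : forall p q : nat, {RV P p q >-> (p.-tuple R * q.-tuple R)%type})
  (hcopy : forall p q : nat, independent_copy (P p q) (XY p q) (XY' p q))
  (* the sample (X_s, Y_s) = S n p q s *)
  (dS : nat -> nat -> nat -> measure_display)
  (TS : forall n p q : nat, measurableType (dS n p q))
  (PS : forall n p q : nat, probability (TS n p q) R)
  (S : forall n p q : nat,
     'I_n -> {RV PS n p q >-> (p.-tuple R * q.-tuple R)%type})
  (hiid : forall n p q : nat,
     iid_copies (P p q) (PS n p q) (XY p q)
       (fun s => S n p q s : TS n p q -> (p.-tuple R * q.-tuple R)%type))
  (* moment bounds, uniform in p and q *)
  (a b a' b' : R) (ha : 0 < a) (ha' : 0 < a')
  (hX : forall (p q : nat) (i : 'I_p),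
     (a%:E <= 'V_(P p q)[fun w => tnth (XY p q w).1 i])%E /\
     ('E_(P p q)[fun w => ((tnth (XY p q w).1 i) ^+ 2)%R] <= b%:E)%E)
  (hY : forall (p q : nat) (j : 'I_q),
     (a'%:E <= 'V_(P p q)[fun w => tnth (XY p q w).2 j])%E /\
     ('E_(P p q)[fun w => ((tnth (XY p q w).2 j) ^+ 2)%R] <= b'%:E)%E)
  (f g : R -> R)
  (hf : f = @gaussian_kernel R \/ f = @laplacian_kernel R)
  (hg : g = @gaussian_kernel R \/ g = @laplacian_kernel R) :
  let X n p q (w : TS n p q) (s : 'I_n) : p.-tuple R := (S n p q s w).1 in
  let Y n p q (w : TS n p q) (s : 'I_n) : q.-tuple R := (S n p q s w).2 in
  let uCov (k l : R -> R -> R) n p q : TS n p q -> R :=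
    uCov2 (PS n p q) k l
      (fun s w => X n p q w s) (fun s w => Y n p q w s) in
  let tauX p q := rms_dist (P p q) (fun w => (XY p q w).1) (fun w => (XY' p q w).1) in
  let tauY p q := rms_dist (P p q) (fun w => (XY p q w).2) (fun w => (XY' p q w).2) in
  let tau p q := tauX p q * tauY p q in
  let LX p q := rel_dev (P p q) (fun w => (XY p q w).1) (fun w => (XY' p q w).1) in
  let LY p q := rel_dev (P p q) (fun w => (XY p q w).2) (fun w => (XY' p q w).2) in
  (* (i) *)
  (exists R1 R2 : forall n p q : nat, TS n p q -> R,
    [/\ forall n p q w,
          dCov2 (X n p q w) (Y n p q w) =
          4^-1 * (Num.sqrt (p%:R * q%:R) / tau p q) *
            uCov (@sq_kernel R) (@sq_kernel R) n p q w + R1 n p q w,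
        forall n p q w,
          let gX := median_dist (X n p q w) in
          let gY := median_dist (Y n p q w) in
          tau p q * hCov2 f g (X n p q w) (Y n p q w) =
          Num.sqrt (p%:R * q%:R) / (4 * gX * gY) *
            derive1 f (tauX p q / gX) * derive1 g (tauY p q / gY) *
            uCov (@sq_kernel R) (@sq_kernel R) n p q w + R2 n p q w &
        forall alpha beta gamma lambda : nat -> nat -> R,
          (forall p q, [/\ 0 <= alpha p q, 0 <= beta p q,
                           0 <= gamma p q & 0 <= lambda p q]) ->
          (forall p q,
             [/\ 'E_(P p q)[fun w => (LX p q w ^+ 2)%R] = (alpha p q ^+ 2)%R%:E,
                 'E_(P p q)[fun w => (LY p q w ^+ 2)%R] = (beta p q ^+ 2)%R%:E,
                 'E_(P p q)[fun w => (LX p q w ^+ 4)%R] = (gamma p q ^+ 2)%R%:E &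
                 'E_(P p q)[fun w => (LY p q w ^+ 4)%R] = (lambda p q ^+ 2)%R%:E])%E ->
        (* n /\ p /\ q -> oo, along (n, p, q) = (ns k, ps k, qs k) *)
        forall ns ps qs : nat -> nat,
          let Al k := alpha (ps k) (qs k) in
          let Be k := beta (ps k) (qs k) in
          let Ga k := gamma (ps k) (qs k) in
          let La k := lambda (ps k) (qs k) in
          let tX k := tauX (ps k) (qs k) in
          let tY k := tauY (ps k) (qs k) in
          let t k := tau (ps k) (qs k) in
          let Pk k := PS (ns k) (ps k) (qs k) in
          let rate k := t k * Al k * La k + t k * Ga k * Be k
                        + t k * Ga k * La k in
          (fun k => minn (minn (ns k) (ps k)) (qs k)) @ \oo --> \oo ->
          (fun k => (ns k)%:R * Al k) @ \oo --> (0 : R) ->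
          (fun k => (ns k)%:R * Be k) @ \oo --> (0 : R) ->
          (fun k => tX k ^+ 2 * (Al k * Ga k + Ga k ^+ 2)) @ \oo --> (0 : R) ->
          (fun k => tY k ^+ 2 * (Be k * La k + La k ^+ 2)) @ \oo --> (0 : R) ->
          (fun k => t k * (Al k * La k + Ga k * Be k + Ga k * La k))
            @ \oo --> (0 : R) ->
          [/\ is_bigO_p Pk
                (fun k => uCov (@sq_kernel R) (@sq_kernel R) (ns k) (ps k) (qs k))
                (fun k => t k * Al k * Be k),
              is_bigO_p Pk (fun k => R1 (ns k) (ps k) (qs k)) rate /\
              is_littleo_p1 Pk (fun k => R1 (ns k) (ps k) (qs k)) &
              is_bigO_p Pk (fun k => R2 (ns k) (ps k) (qs k)) rate /\
              is_littleo_p1 Pk (fun k => R2 (ns k) (ps k) (qs k))]]) /\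
  (* (ii) *)
  (forall n p q : nat, (3 < n)%N ->
    {ae PS n p q, forall w,
      mdCov2 (X n p q w) (Y n p q w) =
      Num.sqrt (p%:R * q%:R) * Num.sqrt ('C(n, 2))%:R *
        uCov (@abs_kernel R) (@abs_kernel R) n p q w}).
Proof.
move=> X Y uCov tauX tauY tau LX LY; split; last first.
  move=> n p q n3; apply/nearW => w.
  by apply: (sample_mdCov2E (hiid n p q)); exact: ltnW.
exists (fun n p q => dCov_remainder (XY p q) (XY' p q) (S n p q)).
exists (fun n p q => hCov_remainder (XY p q) (XY' p q) (S n p q) f g).
split.
- by move=> n p q w; rewrite /dCov_remainder addrC subrK.
- by move=> n p q w gX gY; rewrite /hCov_remainder [RHS]addrC subrK.
move=> al be ga la pos mom ns ps qs Al Be Ga La tX tY t Pk rate lim nAl nBe _ _ rate0.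
(* [Udot_le] asks for n >= 4; p and q must be positive for tau to be positive. *)
have Hlarge : \forall k \near \oo, [/\ (3 < ns k)%N, (0 < ps k)%N & (0 < qs k)%N].
  move/cvgnyPge/(_ 4%N): lim; apply: filterS => k.
  rewrite !leq_min => /andP[/andP[n4 p4] q4].
  by split=> //; [exact: leq_trans p4|exact: leq_trans q4].
have Hbounds (K : R) : 0 < K -> \forall k \near \oo, exists B : set (TS (ns k) (ps k) (qs k)),
    [/\ measurable B, (Pk k B <= (4 * K ^- 2)%:E)%E &
     forall w, ~ B w ->
      [/\ `|uCov (@sq_kernel R) (@sq_kernel R) (ns k) (ps k) (qs k) w|
            <= 288 * Num.sqrt (16 * b * b') * K ^+ 2 * (t k * Al k * Be k),
          `|dCov_remainder (XY (ps k) (qs k)) (XY' (ps k) (qs k))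
              (S (ns k) (ps k) (qs k)) w| <= 5000 * K ^+ 2 * rate k &
          `|hCov_remainder (XY (ps k) (qs k)) (XY' (ps k) (qs k))
              (S (ns k) (ps k) (qs k)) f g w| <= 5000 * K ^+ 2 * rate k]].
  (* Eventually n alpha and n beta are below 1 / (4 K), so that all deviations are at most 1/4 off
     the exceptional set. The rank from which this holds depends on K. *)
  move=> K0; have K4 : 0 < (4 * K)^-1 by rewrite invr_gt0 mulr_gt0.
  near=> k.
  have [n3 p0 q0] : [/\ (3 < ns k)%N, (0 < ps k)%N & (0 < qs k)%N] by near: k.
  have small (x : R) : `|(ns k)%:R * x| < (4 * K)^-1 -> (ns k)%:R * (K * x) <= 1 / 4.
    move=> /ltW /(le_trans (ler_norm _)) /(ler_wpM2l (ltW K0)).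
    by rewrite mulrCA (_ : K / (4 * K) = 1 / 4) //; field; rewrite lt0r_neq0.
  have c1 : (ns k)%:R * (K * Al k) <= 1 / 4.
    by apply: small; near: k; exact: (cvgr0_norm_lt _ nAl).
  have c2 : (ns k)%:R * (K * Be k) <= 1 / 4.
    by apply: small; near: k; exact: (cvgr0_norm_lt _ nBe).
  have [al0 be0 ga0 la0] := pos (ps k) (qs k).
  have [E1 E2 E3 E4] := mom (ps k) (qs k).
  have [B [mB PB HB]] := sample_bounds (hcopy _ _) (hiid (ns k) (ps k) (qs k)) ha ha'
    (hX _ _) (hY _ _) hf hg al0 be0 ga0 la0 E1 E2 E3 E4 n3 p0 q0 K0.
  exists B; split => // w /HB[h1 h2 h3]; split => //; exact: h3.
have rate_cvg : rate @ \oo --> (0 : R).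
  rewrite (_ : rate = fun k => t k * (Al k * La k + Ga k * Be k + Ga k * La k)) //.
  by apply/funext => k; rewrite /rate; ring.
have mu : \forall k \near \oo,
    measurable_fun setT (uCov (@sq_kernel R) (@sq_kernel R) (ns k) (ps k) (qs k)).
  apply: filterS Hlarge => k [n3 p0 q0].
  by apply: (measurable_uCov (hcopy _ _) (hiid _ _ _) ha ha' (hX _ _) (hY _ _)) => //; exact: ltnW.
have m1 : \forall k \near \oo, measurable_fun setT
    (dCov_remainder (XY (ps k) (qs k)) (XY' (ps k) (qs k)) (S (ns k) (ps k) (qs k))).
  apply: filterS Hlarge => k [n3 p0 q0].
  apply: (measurable_dCov_remainder (hcopy _ _) (hiid _ _ _) ha ha' (hX _ _) (hY _ _)) => //.
  exact: ltnW.
have m2 : \forall k \near \oo, measurable_fun setT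
    (hCov_remainder (XY (ps k) (qs k)) (XY' (ps k) (qs k)) (S (ns k) (ps k) (qs k)) f g).
  apply: filterS Hlarge => k [n3 p0 q0].
  apply: (measurable_hCov_remainder (hcopy _ _) (hiid _ _ _) ha ha' (hX _ _) (hY _ _)) => //.
  exact: ltnW.
have O1 := @bigO_p_of_tails R _ _ Pk _ rate m1 5000.
have O2 := @bigO_p_of_tails R _ _ Pk _ rate m2 5000.
have {}O1 : is_bigO_p Pk (fun k => dCov_remainder (XY (ps k) (qs k)) (XY' (ps k) (qs k))
    (S (ns k) (ps k) (qs k))) rate.
  apply: O1 => K /Hbounds; apply: filterS => k [B [mB PB HB]].
  by exists B; split => // w /HB[].
have {}O2 : is_bigO_p Pk (fun k => hCov_remainder (XY (ps k) (qs k)) (XY' (ps k) (qs k))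
    (S (ns k) (ps k) (qs k)) f g) rate.
  apply: O2 => K /Hbounds; apply: filterS => k [B [mB PB HB]].
  by exists B; split => // w /HB[].
split.
- apply: (bigO_p_of_tails mu (C := 288 * Num.sqrt (16 * b * b'))) => K /Hbounds.
  apply: filterS => k [B [mB PB HB]].
  by exists B; split => // w /HB[].
- by split=> //; exact: littleo_p1_of_bigO_p m1 O1 rate_cvg.
- by split=> //; exact: littleo_p1_of_bigO_p m2 O2 rate_cvg.
Unshelve. all: by end_near.
Qed.
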